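(* Let $G$ be a finite abelian group of order $n$ and let $S$ be the set of bijections $\pi:\{1,\dots,n\}\to G$, regarded as a subset of $G^n$ (so sums of bijections are taken pointwise in $G$). Assume $\sum_{x\in G} x = 0$. Then the number of triples $(\pi_1,\pi_2,\pi_3)\in S^3$ with $\pi_1+\pi_2=\pi_3$ is \[ (e^{-1/2}+o(1))\,\frac{n!^3}{n^{n-1}}, \] where $o(1)$ denotes a quantity tending to $0$ as $n\to\infty$, uniformly over all such groups $G$.
   Context: Functions $\{1,\dots,n\}\to G$ are added pointwise: $(\pi_1+\pi_2)(i)=\pi_1(i)+\pi_2(i)$. *)

(* Defs.v *)
From mathcomp Require Import all_boot all_order all_algebra.
From Stdlib Require Import Reals.
Set Implicit Arguments. Unset Strict Implicit. Unset Printing Implicit Defensive.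
Import GRing.Theory.

Definition is_bij (n : nat) (G : finType) (f : {ffun 'I_n -> G}) : bool :=
  injectiveb f && [forall g : G, exists i : 'I_n, f i == g].

Definition sum_triples (G : finZmodType) : nat :=
  #|[set t : {ffun 'I_#|G| -> G} * {ffun 'I_#|G| -> G} * {ffun 'I_#|G| -> G} |
      [&& is_bij t.1.1, is_bij t.1.2, is_bij t.2 &
          [forall i, GRing.add (t.1.1 i) (t.1.2 i) == t.2 i]]]|.

Definition main_term (n : nat) : R :=
  (INR (Factorial.fact n) ^ 3 / INR n ^ (n - 1))%R.

(* Main.v *)
From HB Require Import structures.
From mathcomp Require Import classical_sets filter topology normedtype.
From mathcomp Require Import reals sequences exp.
From mathcomp Require Import all_boot all_order all_algebra all_fingroup all_solvable all_field all_character.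
From mathcomp Require Import complex.
From mathcomp Require Import zify ring lra.
Require Import Defs.

(** Characters of [G^n] are tuples [chi] of [n] characters of [G].  Let [a(chi)] be the average of
    [prod_i chi_i(pi(i))] over bijections [pi]; it is real, because [-pi] is again a bijection, and
    the number of triples is [n!^3 / n^n] times the sum of the [a(chi)^3].  As the elements of [G]
    sum to zero, [a] is invariant under adding a constant to [chi], so the constant tuples contribute
    [n], and the characters close to a constant contribute [n] times those with few nontrivial
    coordinates.  Let [m] be the number of nontrivial coordinates of [chi].

    For bounded [m], replacing a sum over unused values by minus the sum over used values expresses
    [a(chi)] through tuples in which two coordinates are merged.  Up to lower order only merges of
    opposite coordinates matter, whence [m T_m = - T_(m-2) + o(1)] for the sum [T_m] of the cubes, so
    [T_(2k)] tends to [(-1/2)^k / k!], [T_(2k+1)] tends to [0], and the total is [exp(-1/2)].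

    Everything else is negligible.  Cauchy's estimate and AM-GM bound [a(chi)] by
    [prod_v (n/nu_v)^(nu_v/2)] over the size of the orbit of [chi] under permutations, where [nu_v] is
    the multiplicity of the character [v] in [chi].  If [chi] has few distinct values, the sum is
    bounded orbit by orbit; if it has many, the supremum of [a] is multiplied by the [L^2] mass of the
    characters with [m] nontrivial coordinates, which does not depend on [G] and satisfies a
    three-term recursion in [m]. *)

Set Implicit Arguments.
Unset Strict Implicit.
Unset Printing Implicit Defensive.

Import Order.TTheory GRing.Theory Num.Theory.
Local Open Scope ring_scope.

(** * Characters of a finite abelian group *)

(** Size estimates alone cannot settle bounded m: for m = 2k the supremum of |a| is of order n^(-k)
    and the L^2 mass of order n^k, so every even m contributes at order 1 to the sum of |a|^3. There
    the signs have to be followed exactly, with errors smaller by a power of n. For large m it is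
    enough to gain a geometric factor in m. The powers of n cancel in the product of supremum and
    mass; what is left decays if many characters occur in chi, and otherwise there are few orbits.
    Tuples in which no character dominates need only a bounded total, because the main contribution
    has size n. Uniformity in G comes from working with a list of properties of a, [bij_spectrum],
    and from choosing every constant before n, the dual group and a. *)

Lemma closed_prim_root_exists (C : numClosedFieldType) (n : nat) :
  (0 < n)%N -> exists z : C, n.-primitive_root z.
Proof.
move=> n_gt0; have [r Dp] := closed_field_poly_normal ('X^n - 1 : {poly C}).
rewrite (monicP _) ?monicXnsubC // scale1r in Dp.
have rn1 : all n.-unity_root r.
  by apply/allP => z; rewrite -root_prod_XsubC -Dp.
have Ur : uniq r.
  by rewrite -separable_prod_XsubC -Dp separable_Xn_sub_1 // pnatr_eq0 -lt0n.
have sz_r : (n <= size r)%N.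
  by rewrite -ltnS -(size_prod_XsubC r id) -Dp size_XnsubC.
by have /hasP[z _ z_prim] := has_prim_root n_gt0 rn1 Ur sz_r; exists z.
Qed.

Section Dual.
Variable G : finZmodType.
Local Notation n := #|G|.

Definition is_hom (f : {ffun G -> 'Z_n}) :=
  [forall x, forall y, f (x + y) == f x + f y].

Lemma is_homP (f : {ffun G -> 'Z_n}) : reflect (forall x y, f (x + y) = f x + f y) (is_hom f).
Proof.
by apply: (iffP forallP) => [h x y|h x]; [exact/eqP/(forallP (h x))|apply/forallP=> y; apply/eqP].
Qed.

Lemma is_hom_zmod_closed : zmod_closed is_hom.
Proof.
split=> [|f g /is_homP fD /is_homP gD]; apply/is_homP => x y.
  by rewrite !ffunE addr0.
by rewrite !ffunE fD gD opprD addrACA.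
Qed.
HB.instance Definition _ := GRing.isZmodClosed.Build _ is_hom is_hom_zmod_closed.

(** With values in ['Z_n] rather than in a field, the dual is a finite group by construction and
    does not depend on the root of unity [w] that turns it into characters. The modulus of ['Z_n] is
    n only for n > 1, whence [n_gt1]. *)
Record dual := Dual { dual_val :> {ffun G -> 'Z_n}; dual_valP : is_hom dual_val }.
HB.instance Definition _ := [isSub for dual_val].
HB.instance Definition _ := [Finite of dual by <:].
HB.instance Definition _ := [SubChoice_isSubZmodule of dual by <:].

Hypothesis n_gt1 : (1 < n)%N.
Variables (C : numClosedFieldType) (w : C).
Hypothesis w_prim : n.-primitive_root w.

Definition chr (v : dual) (x : G) : C := w ^+ (v x : nat).

Lemma val_ZD (a b : 'Z_n) : (a + b)%R = ((a + b) %% n)%N :> nat.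
Proof. by congr (_ %% _)%N; apply: Zp_cast. Qed.

Lemma prim_expZD (a b : 'Z_n) : w ^+ (a + b)%R = w ^+ a * w ^+ b.
Proof. by rewrite -exprD val_ZD (prim_expr_mod w_prim). Qed.

Lemma chrD v x y : chr v (x + y) = chr v x * chr v y.
Proof. by rewrite /chr (is_homP _ (dual_valP v)) prim_expZD. Qed.

Lemma chrDl u v x : chr (u + v) x = chr u x * chr v x.
Proof. by rewrite /chr -prim_expZD; congr (_ ^+ (nat_of_ord _)); rewrite !ffunE. Qed.

Lemma chr0 x : chr 0 x = 1.
Proof. by rewrite /chr ffunE expr0. Qed.

Lemma chr_norm v x : `|chr v x| = 1.
Proof.
apply/eqP; rewrite -(@pexpr_eq1 _ _ n) ?normr_ge0 //; last by lia.
by rewrite -normrX /chr -exprM mulnC exprM (prim_expr_order w_prim) expr1n normr1.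
Qed.

Lemma chr_neq0 v x : chr v x != 0.
Proof. by rewrite -normr_eq0 chr_norm oner_eq0. Qed.

Lemma chrr0 v : chr v 0 = 1.
Proof. by apply: (mulfI (chr_neq0 v 0)); rewrite -chrD addr0 mulr1. Qed.

Lemma chr_conj v x : (chr v x)^* = chr v (- x).
Proof.
apply: (mulfI (chr_neq0 v x)); rewrite -chrD subrr chrr0 -normCK.
by rewrite chr_norm expr1n.
Qed.

(* A hom to Z/n is read off a linear character by taking discrete logarithms of its values. *)
Lemma dual_separates (x : G) : x != 0 -> exists v, chr v x != 1.
Proof.
move=> x_neq0.
have abG : abelian [set: G] by apply/centsP => a _ b _; apply: addrC.
have [i xNi] : exists i : Iirr [set: G], x \notin cfker 'chi_i.
  apply/existsP; rewrite -negb_forall; apply: contra x_neq0 => /forallP h.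
  have : x \in \bigcap_i cfker 'chi[[set: G]]_i by apply/bigcapP.
  by rewrite TI_cfker_irr => /set1P ->.
have lin_i := char_abelianP _ abG i.
have [z z_prim] := closed_prim_root_exists algC (ltnW n_gt1).
have ex_k y : exists k : 'I_n, 'chi_i y == z ^+ k.
  have : ('chi_i y) ^+ n = 1.
    rewrite -lin_charX ?inE // -cardsT.
    by rewrite (expg_cardG (in_setT y)) lin_char1.
  by move=> /(prim_rootP z_prim)[k ->]; exists k.
pose f := [ffun y => inZp (xchoose (ex_k y)) : 'Z_n].
have fE y : z ^+ (f y) = 'chi_i y.
  rewrite ffunE [RHS](eqP (xchooseP (ex_k y))) -[RHS](prim_expr_mod z_prim).
  by congr (_ ^+ (_ %% _)%N); apply: Zp_cast.
have lt_n (c : 'Z_n) : (c < n)%N by rewrite -[X in (_ < X)%N](Zp_cast n_gt1).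
have f_hom : is_hom f.
  apply/is_homP => a b; apply/val_inj/eqP => /=.
  rewrite -[X in X == _](modn_small (lt_n _)) -/(_ + _) -[X in _ == X](modn_small (lt_n (f a + f b))).
  rewrite -(eq_prim_root_expr z_prim) fE val_ZD (prim_expr_mod z_prim) exprD !fE.
  by rewrite -lin_charM ?inE.
exists (Dual f_hom); rewrite /chr /= -(prim_order_dvd w_prim) (prim_order_dvd z_prim) fE.
by apply: contra xNi; rewrite cfkerEirr inE lin_char1.
Qed.

End Dual.

(** * The Fourier transform of the set of bijections *)

Section Spectrum.
Variable G : finZmodType.
Local Notation n := #|G|.
Hypothesis n_gt1 : (1 < n)%N.
Variables (C : numClosedFieldType) (w : C).
Hypothesis w_prim : n.-primitive_root w.
Local Notation V := (dual G).
Local Notation chr := (chr w).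
Let chrD := chrD n_gt1 w_prim.
Let chrDl := chrDl n_gt1 w_prim.
Let chr_norm := chr_norm n_gt1 w_prim.
Let chr_conj := chr_conj n_gt1 w_prim.

Lemma chr_sum_group (v : V) : \sum_x chr v x = n%:R *+ (v == 0).
Proof.
have [->|v_neq0] := eqVneq v 0.
  by under eq_bigr do rewrite chr0; rewrite sumr_const.
have [x0 vx0] : exists x0, chr v x0 != 1.
  have /existsP[x vx] : [exists x, v x != 0].
    rewrite -negb_forall; apply: contra v_neq0 => /forallP h.
    by apply/eqP/val_inj/ffunP => x; rewrite ffunE; apply/eqP.
  exists x; rewrite /chr -(prim_order_dvd w_prim).
  apply: contra vx => /dvdn_leq h; rewrite -val_eqE /= eqn0Ngt; apply/negP => /h.
  by rewrite leqNgt -[X in (_ < X)%N](Zp_cast n_gt1) ltn_ord.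
have: chr v x0 * (\sum_x chr v x) = \sum_x chr v x.
  rewrite mulr_sumr [RHS](reindex_inj (addrI x0)) /=.
  by apply: eq_bigr => x _; rewrite chrD.
move/eqP; rewrite -subr_eq0 -{2}[\sum_x _]mul1r -mulrBl mulf_eq0 subr_eq0 (negPf vx0).
by move=> /eqP.
Qed.

Lemma chr_sum_dual_neq0 (x : G) : x != 0 -> \sum_v chr v x = 0.
Proof.
move=> /(dual_separates n_gt1 w_prim)[v0 v0x].
have: chr v0 x * (\sum_v chr v x) = \sum_v chr v x.
  rewrite mulr_sumr [RHS](reindex_inj (addrI v0)) /=.
  by apply: eq_bigr => v _; rewrite chrDl.
move/eqP; rewrite -subr_eq0 -{2}[\sum_v _]mul1r -mulrBl mulf_eq0 subr_eq0 (negPf v0x).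
by move=> /eqP.
Qed.

(** Double counting: the sum of [chr v x] over all pairs reduces to v = 0 in one order of summation
    and to x = 0 in the other. *)
Lemma card_dual : #|{: V}| = n.
Proof.
have: \sum_(v : V) \sum_(x : G) chr v x = \sum_(x : G) \sum_(v : V) chr v x.
  by rewrite exchange_big.
rewrite (bigD1 0) //= chr_sum_group eqxx big1 ?addr0; last first.
  by move=> v /negPf v0; rewrite chr_sum_group v0.
rewrite (bigD1 0) //= [X in _ = _ + X]big1 ?addr0; last exact: chr_sum_dual_neq0.
under eq_bigr do rewrite (chrr0 n_gt1 w_prim).
by rewrite sumr_const => /eqP; rewrite eqr_nat => /eqP.
Qed.

Lemma chr_sum_dual (x : G) : \sum_v chr v x = n%:R *+ (x == 0).
Proof.
have [->|/chr_sum_dual_neq0 //] := eqVneq x 0.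
under eq_bigr do rewrite (chrr0 n_gt1 w_prim).
by rewrite sumr_const card_dual.
Qed.

Definition numbering : 'I_n -> G := @enum_val G G.
Local Notation b := numbering.

Lemma numbering_bij : bijective b. Proof. exact: enum_val_bij. Qed.
Let b_inj := bij_inj numbering_bij.

Lemma sum_numbering (M : nmodType) (F : G -> M) : \sum_i F (b i) = \sum_x F x.
Proof. by rewrite [RHS](reindex b) //=; apply: onW_bij numbering_bij. Qed.

Lemma chr_orth (u v : V) : \sum_i chr u (b i) * (chr v (b i))^* = n%:R *+ (u == v).
Proof.
rewrite -subr_eq0 -chr_sum_group -sum_numbering; apply: eq_bigr => i _.
have <- : chr (- v) (b i) = (chr v (b i))^*.
  apply: (mulfI (chr_neq0 n_gt1 w_prim v (b i))); rewrite -chrDl subrr chr0.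
  by rewrite -normCK chr_norm expr1n.
by rewrite chrDl.
Qed.

Lemma chr_orth_dual (i j : 'I_n) :
  \sum_v chr v (b i) * (chr v (b j))^* = n%:R *+ (i == j).
Proof.
under eq_bigr do rewrite chr_conj -chrD.
by rewrite chr_sum_dual subr_eq0 (inj_eq b_inj).
Qed.

Local Notation freq := {ffun 'I_n -> V}.
(** Every bijection onto G is [numbering] after a unique permutation, so averaging over ['S_n]
    averages over bijections; [spec] is the coefficient a(chi) of the overview. *)
Definition phase (chi : freq) (s : 'S_n) : C := \prod_i chr (chi i) (b (s i)).
Definition spec (chi : freq) : C := (n`!%:R)^-1 * \sum_s phase chi s.

Lemma spec_perm (t : 'S_n) (chi : freq) : spec [ffun i => chi (t i)] = spec chi.
Proof.
congr (_ * _); rewrite (reindex_inj (mulgI t)) /=; apply: eq_bigr => s _.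
rewrite [RHS](reindex_inj (@perm_inj _ t)) /=.
by apply: eq_bigr => i _; rewrite ffunE permM.
Qed.

(** Adding v multiplies each phase by the value of v at the sum of all elements of G. The hypothesis
    on this sum enters here. *)
Lemma spec_shift (v : V) (chi : freq) :
  \sum_(x : G) x = 0 -> spec [ffun i => chi i + v] = spec chi.
Proof.
move=> sumG; congr (_ * _); apply: eq_bigr => s _.
rewrite -[RHS]mulr1 -[1](chrr0 n_gt1 w_prim v) -sumG -[\sum_x x]sum_numbering.
rewrite [\sum_i b i](reindex_inj (@perm_inj _ s)) /=.
rewrite (big_morph _ (chrD v) (chrr0 n_gt1 w_prim v)) -big_split /=.
by apply: eq_bigr => i _; rewrite ffunE chrDl.
Qed.

Lemma spec0 : spec 0 = 1.
Proof.
rewrite /spec (eq_bigr (fun=> 1)) => [|s _]; last first.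
  by apply: big1 => i _; rewrite ffunE chr0.
by rewrite sumr_const card_Sn mulVf // pnatr_eq0 -lt0n fact_gt0.
Qed.

(** The character at p is transferred onto position q, leaving the trivial one at p. The two terms
    are arranged so that q = p returns chi itself, hence q may range over all positions. *)
Definition move (W : zmodType) (N : nat) (chi : {ffun 'I_N -> W}) (p q : 'I_N) :=
  [ffun i => chi i *+ (i != p) + chi p *+ (i == q)].

(** For a fixed permutation the factors away from p do not depend on q, and the character [chi p] is
    evaluated once at every element of G. *)
Lemma spec_move (chi : freq) (p : 'I_n) : chi p != 0 -> \sum_q spec (move chi p q) = 0.
Proof.
move=> chip; rewrite -mulr_sumr exchange_big /= big1 ?mulr0 // => s _.
have h q : phase (move chi p q) s =
    (\prod_(i | i != p) chr (chi i) (b (s i))) * chr (chi p) (b (s q)).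
  rewrite /phase; under eq_bigr do rewrite ffunE chrDl.
  rewrite big_split /=; congr (_ * _).
    rewrite [LHS](bigID (fun i => i != p)) /= [X in _ * X]big1 ?mulr1; last first.
      by move=> i /negPf ->; rewrite mulr0n chr0.
    by apply: eq_bigr => i ->.
  rewrite (bigD1 q) //= eqxx big1 ?mulr1 // => i /negPf ->.
  by rewrite mulr0n chr0.
under eq_bigr do rewrite h.
rewrite -mulr_sumr; have -> : \sum_i chr (chi p) (b (s i)) = \sum_i chr (chi p) (b i).
  by rewrite [RHS](reindex_inj (@perm_inj _ s)).
by rewrite (sum_numbering (chr (chi p))) chr_sum_group (negPf chip) mulr0n mulr0.
Qed.

Lemma spec_conj (chi : freq) : (spec chi)^* = spec chi.
Proof.
rewrite rmorphM fmorphV rmorph_nat rmorph_sum; congr (_ * _).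
have [c bK cK] := numbering_bij.
have opp_inj : injective (fun i => c (- b i)).
  by move=> i j /(can_inj cK)/oppr_inj/b_inj.
rewrite [RHS](reindex_inj (mulIg (perm opp_inj))) /=; apply: eq_bigr => s _.
by rewrite rmorph_prod; apply: eq_bigr => i _; rewrite permM permE cK -chr_conj.
Qed.

Definition supp (W : zmodType) (N : nat) (chi : {ffun 'I_N -> W}) := [set i | chi i != 0].

Lemma in_supp (W : zmodType) (N : nat) (chi : {ffun 'I_N -> W}) i : (i \in supp chi) = (chi i != 0).
Proof. by rewrite inE. Qed.

Lemma prod_agree (A : {set 'I_n}) (s t : 'S_n) :
  \prod_i \sum_(v | (i \notin A) ==> (v == 0)) chr v (b (s i)) * (chr v (b (t i)))^* =
  n%:R ^+ #|A| *+ [forall i in A, s i == t i].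
Proof.
rewrite (bigID (mem A)) /= [X in _ * X]big1 ?mulr1; last first.
  by move=> i /negPf iA; rewrite iA /= (big_pred1 0) // !chr0 conjC1 mulr1.
rewrite (eq_bigr (fun i => n%:R *+ (s i == t i))) => [|i iA]; last first.
  by rewrite -chr_orth_dual; apply: eq_bigl => v; rewrite iA.
case: forall_inP => [h|nh].
  by rewrite mulr1n -prodr_const; apply: eq_bigr => i /h ->.
have /existsP[i /andP[iA /negPf si]] : [exists i, (i \in A) && (s i != t i)].
  rewrite -[X in is_true X]negbK negb_exists; apply/negP => /forallP h; apply: nh => i iA.
  by have := h i; rewrite iA negbK.
by rewrite (bigD1 i) //= si mul0r.
Qed.

Lemma card_agree (A : {set 'I_n}) (s : 'S_n) :
  #|[set t : 'S_n | [forall i in A, s i == t i]]| = (n - #|A|)`!.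
Proof.
have -> : (n - #|A|)%N = #|~: A|.
  by have := cardsC A; rewrite card_ord; lia.
rewrite -card_perm -[RHS](card_imset _ (mulIg s)); apply/eq_card => t.
rewrite inE; apply/forall_inP/imsetP => [h|[u u_on ->] i iA].
  exists (t * s^-1)%g; last by rewrite mulgKV.
  apply/subsetP => i; rewrite inE permM; apply: contraR; rewrite !inE negbK => /h /eqP <-.
  by rewrite permK.
by rewrite permM (out_perm u_on) // inE negbK.
Qed.

(** Parseval on a face: summing over all characters at the positions of A, with the trivial one
    elsewhere, retains the pairs of permutations that agree on A. There are n! (n - |A|)! of them,
    each with weight n^|A|. *)
Lemma spec_mass (A : {set 'I_n}) :
  \sum_(chi : freq | supp chi \subset A) spec chi ^+ 2 =
  n%:R ^+ #|A| * (n - #|A|)`!%:R / n`!%:R.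
Proof.
have fact_neq0 : n`!%:R != 0 :> C by rewrite pnatr_eq0 -lt0n fact_gt0.
have -> : \sum_(chi : freq | supp chi \subset A) spec chi ^+ 2 =
    (n`!%:R)^-2 * \sum_s \sum_t \sum_(chi : freq | supp chi \subset A)
      phase chi s * (phase chi t)^*.
  under [X in _ * X]eq_bigr do rewrite exchange_big /=.
  rewrite exchange_big mulr_sumr; apply: eq_bigr => chi _.
  rewrite expr2 -{2}spec_conj rmorphM fmorphV rmorph_nat rmorph_sum mulrACA.
  rewrite -expr2 exprVn; congr (_ * _); rewrite mulr_suml.
  by apply: eq_bigr => s _; rewrite mulr_sumr.
have h s t : \sum_(chi : freq | supp chi \subset A) phase chi s * (phase chi t)^* =
    n%:R ^+ #|A| *+ [forall i in A, s i == t i].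
  rewrite -prod_agree (bigA_distr_big_dep (fun i v => (i \notin A) ==> (v == 0))) /=.
  apply: eq_big => [chi|chi _]; last first.
    by rewrite rmorph_prod -big_split.
  apply/subsetP/familyP => [h i|h i]; rewrite ?inE.
    apply/implyP; apply: contraR => chii; apply: h; by rewrite in_supp.
  by apply: contraR => iA; have /implyP/(_ iA) := h i.
have h2 s : \sum_t \sum_(chi : freq | supp chi \subset A) phase chi s * (phase chi t)^* =
    n%:R ^+ #|A| * (n - #|A|)`!%:R.
  under eq_bigr do rewrite h; rewrite -(card_agree A s) sumrMnr -sum1dep_card.
  rewrite mulr_natr; congr (_ *+ _).
  by rewrite [RHS]big_mkcond; apply: eq_bigr => t _; case: ifP.
rewrite (eq_bigr _ (fun s _ => h2 s)) sumr_const card_Sn -mulr_natr.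
by field.
Qed.

End Spectrum.

(** * Counting triples by Fourier inversion *)

Section Count.
Variable G : finZmodType.
Local Notation n := #|G|.
Hypothesis n_gt1 : (1 < n)%N.
Variables (C : numClosedFieldType) (w : C).
Hypothesis w_prim : n.-primitive_root w.
Local Notation V := (dual G).
Local Notation chr := (chr w).
Local Notation b := (@numbering G).
Local Notation freq := {ffun 'I_n -> V}.
Local Notation spec := (@spec G C w).
Local Notation phase := (@phase G C w).
Let chrD := chrD n_gt1 w_prim.
Let chr_conj := chr_conj n_gt1 w_prim.

Lemma sum_triples_perm : sum_triples G =
  #|[set t : 'S_n * 'S_n * 'S_n | [forall i, b (t.1.1 i) + b (t.1.2 i) == b (t.2 i)]]|.
Proof.
have b_inj := bij_inj (numbering_bij G).
pose g (s : 'S_n) := [ffun i => b (s i)].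
have g_inj : injective g.
  by move=> s t /ffunP h; apply/permP => i; have := h i; rewrite !ffunE => /b_inj.
have g_bij s : is_bij (g s).
  apply/andP; split.
    by apply/injectiveP => i j; rewrite !ffunE => /b_inj/perm_inj.
  apply/forallP => x; have [c _ cK] := numbering_bij G.
  by apply/existsP; exists ((s^-1)%g (c x)); rewrite ffunE permKV cK.
have g_onto f : is_bij f -> exists s, f = g s.
  case/andP => /injectiveP f_inj _; have [c bK cK] := numbering_bij G.
  have cf_inj : injective (fun i => c (f i)) by move=> i j /(can_inj cK)/f_inj.
  by exists (perm cf_inj); apply/ffunP => i; rewrite ffunE permE cK.
pose g3 (t : 'S_n * 'S_n * 'S_n) := (g t.1.1, g t.1.2, g t.2).
have g3_inj : injective g3.
  by move=> [[s1 s2] s3] [[t1 t2] t3] [/g_inj -> /g_inj -> /g_inj ->].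
rewrite -[RHS](card_imset _ g3_inj); apply/eq_card => -[[f1 f2] f3].
rewrite inE; apply/and4P/imsetP => /= [[]|[t]].
  move=> /g_onto[s1 ->] /g_onto[s2 ->] /g_onto[s3 ->] h.
  exists (s1, s2, s3) => //; rewrite inE; apply/forallP => i /=.
  by have := forallP h i; rewrite !ffunE.
rewrite inE => /forallP h [-> -> ->]; split; rewrite ?g_bij //.
by apply/forallP => i; rewrite !ffunE.
Qed.

(** By orthogonality at each position, the condition on a triple is n^(-n) times the sum over chi of
    two phases and a conjugate phase; as [spec] is real, these combine to a cube. *)
Lemma sum_triples_spec :
  (sum_triples G)%:R = n`!%:R ^+ 3 / n%:R ^+ n * \sum_(chi : freq) spec chi ^+ 3.
Proof.
have n_neq0 : n%:R != 0 :> C by rewrite pnatr_eq0 -lt0n ltnW.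
have fact_neq0 : n`!%:R != 0 :> C by rewrite pnatr_eq0 -lt0n fact_gt0.
have b_inj := bij_inj (numbering_bij G).
have ind (t : 'S_n * 'S_n * 'S_n) :
    \sum_(chi : freq) phase chi t.1.1 * phase chi t.1.2 * (phase chi t.2)^* =
    n%:R ^+ n *+ [forall i, b (t.1.1 i) + b (t.1.2 i) == b (t.2 i)].
  transitivity (\prod_i \sum_(v : V) chr v (b (t.1.1 i) + b (t.1.2 i) - b (t.2 i))).
    rewrite bigA_distr_bigA /=; apply: eq_bigr => chi _.
    rewrite rmorph_prod -!big_split /=; apply: eq_bigr => i _.
    by rewrite !chrD -chr_conj.
  under eq_bigr do rewrite (chr_sum_dual n_gt1 w_prim) subr_eq0.
  case: forallP => [h|/forallP].
    rewrite (eq_bigr (fun=> n%:R)) => [|i _]; last by rewrite h.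
    by rewrite prodr_const card_ord.
  by rewrite negb_forall => /existsP[i /negPf hi]; rewrite (bigD1 i) //= hi mul0r.
rewrite sum_triples_perm -sum1dep_card natr_sum.
have -> : \sum_(t : 'S_n * 'S_n * 'S_n | [forall i, b (t.1.1 i) + b (t.1.2 i) == b (t.2 i)]) 1%:R =
    (n%:R ^+ n)^-1 * \sum_(t : 'S_n * 'S_n * 'S_n) \sum_(chi : freq)
      phase chi t.1.1 * phase chi t.1.2 * (phase chi t.2)^* :> C.
  rewrite mulr_sumr [LHS]big_mkcond; apply: eq_bigr => t _; rewrite ind.
  by case: ifP => _; rewrite ?mulr0n ?mulr0 // mulr1n mulVf // expf_neq0.
rewrite exchange_big /= [in RHS]mulrAC [in RHS]mulrC; congr (_ * _).
rewrite mulr_sumr; apply: eq_bigr => chi _.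
have sE : n`!%:R * spec chi = \sum_s phase chi s by rewrite mulrA mulfV ?mul1r.
have -> : n`!%:R ^+ 3 * spec chi ^+ 3 =
    (n`!%:R * spec chi) * (n`!%:R * spec chi) * (n`!%:R * spec chi)^*.
  by rewrite rmorphM rmorph_nat /= (spec_conj n_gt1 w_prim); ring.
rewrite sE big_distrlr /= pair_bigA /= rmorph_sum big_distrlr /= pair_bigA /=.
by [].
Qed.
End Count.

(** * Colour multiplicities and orbits under permutations of positions *)

Section Occ.
Variables (N : nat) (W : finType).
Implicit Types (chi psi : {ffun 'I_N -> W}) (v : W) (s : 'S_N).

Definition occ chi v := #|[set i | chi i == v]|.

Lemma occE chi v : occ chi v = count_mem v [seq chi i | i <- enum 'I_N].
Proof.
rewrite count_map /occ cardsE cardE enumT /enum_mem size_filter.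
by apply: eq_count => i.
Qed.

Definition rearrangements chi := [set psi : {ffun 'I_N -> W} | [forall v, occ psi v == occ chi v]].

Lemma rearrangementsP chi psi :
  reflect (exists s : 'S_N, psi = [ffun i => chi (s i)]) (psi \in rearrangements chi).
Proof.
rewrite inE; apply: (iffP forallP) => [h|[s ->] v]; last first.
  rewrite /occ -(card_imset [set i | [ffun j => chi (s j)] i == v] (@perm_inj _ s)).
  apply/eqP/eq_card => i; rewrite [in RHS]inE; apply/imsetP/eqP => [[j + ->]|chii].
    by rewrite inE ffunE => /eqP.
  by exists ((s^-1)%g i); rewrite ?inE ?ffunE permKV // chii.
have /tuple_permP[s Es] : perm_eq [seq psi i | i <- enum 'I_N] [tuple chi i | i < N].
  apply/allP => v _ /=; rewrite -!occE; exact: h.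
exists s; apply/ffunP => i; rewrite ffunE.
have := congr1 (fun t => nth (psi i) t i) Es.
by rewrite -tnth_nth !tnth_mktuple (nth_map i) ?size_enum_ord // nth_ord_enum.
Qed.

(** A permutation fixing chi preserves every colour class and is determined by its restrictions to
    them. *)
Lemma card_stabiliser_le chi :
  (#|[set s : 'S_N | [forall i, chi (s i) == chi i]]| <= \prod_v (occ chi v)`!)%N.
Proof.
pose F v := perm_on [set i | chi i == v].
pose K := [set s : 'S_N | [forall i, chi (s i) == chi i]].
have -> : (\prod_v (occ chi v)`! = #|family F|)%N.
  rewrite card_family foldrE big_map big_enum /=.
  by apply: eq_bigr => v _; rewrite card_perm.
pose f (s : 'S_N) := [ffun v => restr_perm [set i | chi i == v] s].
have astab s v : s \in K -> s \in ('N([set i | chi i == v] | 'P))%g.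
  rewrite inE => /forallP h; apply/astabsP => i; rewrite !inE /aperm.
  by rewrite (eqP (h i)).
have f_inj : {in K &, injective f}.
  move=> s t sK tK fst; apply/permP => i.
  have := congr1 (fun g : {ffun W -> 'S_N} => g (chi i) i) fst.
  by rewrite !ffunE !restr_permE //; rewrite ?astab // inE.
rewrite -/K -(card_in_imset f_inj); apply/subset_leq_card/subsetP => g /imsetP[s sK ->].
by apply/familyP => v; rewrite ffunE; apply: restr_perm_on.
Qed.

(** Orbit counting: two permutations carrying chi to the same psi differ by an element of the
    stabiliser of psi. *)
Lemma fact_le_rearrangements chi :
  (N`! <= #|rearrangements chi| * \prod_v (occ chi v)`!)%N.
Proof.
pose act (s : 'S_N) := [ffun i => chi (s i)].
rewrite -card_Sn -[X in (X <= _)%N]sum1_card (partition_big act (fun psi => psi \in rearrangements chi)) /=; last first.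
  by move=> s _; apply/rearrangementsP; exists s.
rewrite -sum_nat_const; apply: leq_sum => psi /[dup] psi_in.
rewrite inE => /forallP occE.
rewrite (eq_bigr (fun v => (occ psi v)`!)) => [|v _]; last by rewrite (eqP (occE v)).
apply: leq_trans (card_stabiliser_le psi).
rewrite sum1dep_card; have /rearrangementsP[s0 Es0] := psi_in.
rewrite -(card_imset _ (mulIg s0^-1%g)); apply/subset_leq_card/subsetP => t /imsetP[s].
rewrite !inE => /eqP Es ->; apply/forallP => i; rewrite permM.
by rewrite {1}Es0 ffunE permKV -Es ffunE.
Qed.

Lemma sum_occ chi : (\sum_v occ chi v = N)%N.
Proof.
rewrite -[RHS]card_ord -sum1_card (partition_big chi predT) //=.
by apply: eq_bigr => v _; rewrite sum1dep_card.
Qed.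

Lemma prod_occ (R : comPzSemiRingType) chi (F : W -> R) : \prod_i F (chi i) = \prod_v F v ^+ occ chi v.
Proof.
rewrite (partition_big chi predT) //=; apply: eq_bigr => v _.
by rewrite -prodr_const; apply: eq_big => [i|i /eqP ->]; rewrite ?inE.
Qed.

End Occ.

(** * Pointwise bound by Cauchy's estimate *)

Section SupBound.
Variable G : finZmodType.
Local Notation n := #|G|.
Hypothesis n_gt1 : (1 < n)%N.
Variables (C : numClosedFieldType) (w : C).
Hypothesis w_prim : n.-primitive_root w.
Local Notation V := (dual G).
Local Notation chr := (chr w).
Local Notation b := (@numbering G).
Local Notation freq := {ffun 'I_n -> V}.
Local Notation spec := (@spec G C w).
Local Notation phase := (@phase G C w).

(** Composition with a permutation preserves the orbit of chi, so averaging over permutations or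
    over the orbit is the same. The left side is a coefficient of a product of n linear forms, to
    which Cauchy's estimate applies. *)
Lemma sum_rearrangements_phase (chi : freq) :
  \sum_(psi in rearrangements chi) \prod_i chr (psi i) (b i) =
  #|rearrangements chi|%:R * spec chi.
Proof.
have fact_neq0 : n`!%:R != 0 :> C by rewrite pnatr_eq0 -lt0n fact_gt0.
have spec_r psi : psi \in rearrangements chi -> spec psi = spec chi.
  by move=> /rearrangementsP[s ->]; apply: spec_perm.
rewrite mulr_natl -sumr_const -(eq_bigr _ spec_r) -mulr_sumr exchange_big /=.
rewrite [X in _ = _ * X](eq_bigr (fun=> \sum_(psi in rearrangements chi) \prod_i chr (psi i) (b i))).
  by rewrite sumr_const card_Sn -[X in _^-1 * X]mulr_natl mulKf.
move=> s _.
have shift_inj : injective (fun psi : freq => [ffun i => psi (s i)]).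
  move=> f g /ffunP h; apply/ffunP => i; have := h (s^-1 i)%g.
  by rewrite !ffunE permKV.
rewrite [LHS](reindex_inj shift_inj) /=; apply: eq_big => [psi|psi _].
  apply/rearrangementsP/rearrangementsP => -[t Et].
    exists (s^-1 * t)%g; apply/ffunP => i; have /ffunP/(_ (s^-1 i)%g) := Et.
    by rewrite !ffunE permKV permM.
  by exists (s * t)%g; apply/ffunP => i; rewrite Et !ffunE permM.
rewrite /phase [RHS](reindex_inj (@perm_inj _ s)) /=.
by apply: eq_bigr => i _; rewrite ffunE.
Qed.

(* Cauchy's estimate for the coefficient of prod_v X_v^(occ chi v) in prod_i (sum_v v(b i) X_v) on the
   torus |X_v|^2 = occ chi v, integrated over (n+1)-th roots of unity; on that torus AM-GM over i and
   orthogonality of characters bound the product by n^(n/2). *)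
Lemma rearrangements_spec_bound (chi : freq) :
  #|rearrangements chi|%:R ^+ 2 * spec chi ^+ 2 * (\prod_v (occ chi v) ^ (occ chi v))%N%:R
    <= n%:R ^+ n :> C.
Proof.
have n_gt0 : (0 < n)%N by apply: ltnW.
have [z z_prim] := closed_prim_root_exists C (ltn0Sn n).
have z_norm k : `|z ^+ k| = 1.
  apply/eqP; rewrite -(@pexpr_eq1 _ _ n.+1) ?normr_ge0 //.
  by rewrite -normrX -exprM mulnC exprM (prim_expr_order z_prim) expr1n normr1.
pose r v : C := sqrtC (occ chi v)%:R.
pose Phi (o : {ffun V -> 'I_n.+1}) := \prod_i \sum_v chr v (b i) * (r v * z ^+ o v).
pose mass := \prod_v r v ^+ occ chi v.
have geom (k l : nat) : (k <= n)%N -> (l <= n)%N ->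
    \sum_(j < n.+1) (z ^+ j) ^+ k * ((z ^+ j) ^+ l)^* = n.+1%:R *+ (k == l).
  move=> kn ln; pose u := z ^+ k * (z ^+ l)^*.
  have -> : \sum_(j < n.+1) (z ^+ j) ^+ k * ((z ^+ j) ^+ l)^* = \sum_(j < n.+1) u ^+ j.
    by apply: eq_bigr => j _; rewrite exprMn -rmorphXn -!exprM !(mulnC j).
  have u_eq1 : (u == 1) = (k == l).
    rewrite /u -(inj_eq (mulIf (x := z ^+ l) _)); last by rewrite -normr_eq0 z_norm oner_eq0.
    rewrite -mulrA [_^* * _]mulrC -normCK z_norm expr1n mulr1 mul1r.
    by rewrite (eq_prim_root_expr z_prim) !modn_small.
  rewrite -u_eq1; have [->|u_neq1] := eqVneq u 1.
    by under eq_bigr do rewrite expr1n; rewrite sumr_const card_ord.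
  have : (u - 1) * \sum_(j < n.+1) u ^+ j = 0.
    rewrite -subrX1 exprMn -rmorphXn -!exprM !(mulnC _ n.+1) !exprM.
    by rewrite (prim_expr_order z_prim) !expr1n /= conjC1 mul1r subrr.
  by move/eqP; rewrite mulf_eq0 subr_eq0 (negPf u_neq1) => /eqP.
have occ_le (psi : freq) v : (occ psi v <= n)%N.
  by apply: leq_trans (max_card _) _; rewrite card_ord.
have extract : \sum_o Phi o * \prod_v ((z ^+ o v) ^+ occ chi v)^* =
    n.+1%:R ^+ #|{: V}| * mass * (#|rearrangements chi|%:R * spec chi).
  rewrite -sum_rearrangements_phase.
  have PhiE (o : {ffun V -> 'I_n.+1}) : Phi o = \sum_(psi : freq)
      (\prod_i chr (psi i) (b i)) * ((\prod_v r v ^+ occ psi v) * \prod_v (z ^+ o v) ^+ occ psi v).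
    rewrite /Phi bigA_distr_bigA; apply: eq_bigr => psi _ /=.
    by rewrite -(prod_occ psi r) -(prod_occ psi (fun v => z ^+ o v)) -!big_split.
  under eq_bigr do rewrite PhiE mulr_suml.
  rewrite exchange_big /= mulr_sumr [RHS]big_mkcond /=; apply: eq_bigr => psi _.
  transitivity ((\prod_i chr (psi i) (b i)) * (\prod_v r v ^+ occ psi v) *
      \prod_v (n.+1%:R *+ (occ psi v == occ chi v))).
    under [X in _ = _ * X]eq_bigr do rewrite -geom //.
    rewrite bigA_distr_bigA mulr_sumr /=; apply: eq_bigr => o _.
    by rewrite -!mulrA; do 2!congr (_ * _); rewrite big_split.
  rewrite inE; case: forallP => [h|/forallP].
    have -> : \prod_v r v ^+ occ psi v = mass by apply: eq_bigr => v _; rewrite (eqP (h v)).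
    have -> : \prod_v (n.+1%:R *+ (occ psi v == occ chi v)) = n.+1%:R ^+ #|{: V}| :> C.
      by rewrite -prodr_const; apply: eq_bigr => v _; rewrite (eqP (h v)) eqxx.
    by rewrite [RHS]mulrC -mulrA [mass * _]mulrC.
  by rewrite negb_forall => /existsP[v /negPf hv]; rewrite [X in _ * X](bigD1 v) //= hv mul0r mulr0.
have Phi_le o : `|Phi o| ^+ 2 <= n%:R ^+ n.
  pose y v := r v * z ^+ o v.
  have sumy : \sum_i `|\sum_v chr v (b i) * y v| ^+ 2 = n%:R * n%:R.
    under eq_bigr do rewrite normCK rmorph_sum big_distrlr /=.
    rewrite exchange_big /= -[X in _ * X%:R](sum_occ chi) natr_sum mulr_sumr.
    apply: eq_bigr => v _; rewrite exchange_big /=.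
    rewrite (bigD1 v) //= [X in _ + X]big1 ?addr0.
      under eq_bigr do rewrite rmorphM mulrACA /=.
      rewrite -mulr_suml (chr_orth n_gt1 w_prim) eqxx; congr (_ * _).
      by rewrite -normCK normrM z_norm mulr1 ger0_norm ?sqrtC_ge0 ?ler0n // sqrtCK.
    move=> u /negPf uv; under eq_bigr do rewrite rmorphM mulrACA /=.
    by rewrite -mulr_suml (chr_orth n_gt1 w_prim) eq_sym uv mul0r.
  rewrite /Phi normr_prod -prodrXl.
  have [] := leif_AGM (A := 'I_n) (E := fun i => `|\sum_v chr v (b i) * y v| ^+ 2).
    by move=> i _; rewrite exprn_ge0.
  by rewrite card_ord sumy mulfK // pnatr_eq0 -lt0n.
have main : mass * `|#|rearrangements chi|%:R * spec chi| <= sqrtC (n%:R ^+ n).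
  have Npos : 0 < n.+1%:R ^+ #|{: V}| :> C by rewrite exprn_gt0 ?ltr0n.
  have mass_ge0 : 0 <= mass by apply: prodr_ge0 => v _; rewrite exprn_ge0 // sqrtC_ge0 ler0n.
  rewrite -(ler_pM2l Npos) mulrA -[X in X * `|_|]ger0_norm; last by rewrite mulr_ge0 // ltW.
  rewrite -normrM -extract; apply: le_trans (ler_norm_sum _ _ _) _.
  have -> : n.+1%:R ^+ #|{: V}| = #|{: {ffun V -> 'I_n.+1}}|%:R :> C.
    by rewrite card_ffun card_ord natrX.
  rewrite mulr_natl -sumr_const; apply: ler_sum => o _.
  rewrite normrM [X in _ * X](_ : _ = 1) ?mulr1.
    rewrite -(@ler_pXn2r _ 2) ?nnegrE ?sqrtC_ge0 ?exprn_ge0 ?ler0n // sqrtCK; exact: Phi_le.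
  by rewrite normr_prod big1 // => v _; rewrite norm_conjC normrX z_norm expr1n.
have massE : mass ^+ 2 = (\prod_v (occ chi v) ^ (occ chi v))%N%:R.
  by rewrite natr_prod -prodrXl; apply: eq_bigr => v _; rewrite exprAC sqrtCK natrX.
rewrite -massE [X in X <= _]mulrC -exprMn -exprMn -[X in _ <= X](sqrtCK (n%:R ^+ n)).
have cc : (mass * (#|rearrangements chi|%:R * spec chi)) ^+ 2 =
    (mass * `|#|rearrangements chi|%:R * spec chi|) ^+ 2.
  rewrite [LHS]exprMn [RHS]exprMn normCK rmorphM rmorph_nat /=.
  by rewrite (spec_conj n_gt1 w_prim) expr2.
rewrite cc; apply: lerXn2r main; rewrite nnegrE ?sqrtC_ge0 ?exprn_ge0 ?ler0n //.
by rewrite mulr_ge0 // prodr_ge0 // => v _; rewrite exprn_ge0 // sqrtC_ge0 ler0n.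
Qed.

Lemma spec_sqr_ge0 (chi : freq) : 0 <= spec chi ^+ 2.
Proof. by rewrite expr2 -{2}(spec_conj n_gt1 w_prim) -normCK exprn_ge0. Qed.

Lemma spec_sup (chi : freq) :
  spec chi ^+ 2 * n`!%:R ^+ 2 * (\prod_v (occ chi v) ^ (occ chi v))%N%:R
    <= n%:R ^+ n * (\prod_v (occ chi v)`!)%N%:R ^+ 2 :> C.
Proof.
have h := rearrangements_spec_bound chi.
have h2 : n`!%:R <= #|rearrangements chi|%:R * (\prod_v (occ chi v)`!)%N%:R :> C.
  by rewrite -natrM ler_nat fact_le_rearrangements.
apply: le_trans (ler_wpM2r _ h); last by rewrite exprn_ge0 ?ler0n.
rewrite [X in _ <= X](_ : _ = spec chi ^+ 2 * (#|rearrangements chi|%:R * (\prod_v (occ chi v)`!)%N%:R) ^+ 2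
   * (\prod_v (occ chi v) ^ (occ chi v))%N%:R); last by ring.
by rewrite ler_wpM2r ?ler0n // ler_wpM2l ?spec_sqr_ge0 // lerXn2r ?nnegrE ?mulr_ge0 ?ler0n.
Qed.

End SupBound.

(** * The spectrum of the set of bijections over the reals *)

(** The analysis works from these properties alone, so constants chosen before n, V and a are
    automatically uniform in G. The L^2 information is kept for every face A, since the mass at a
    given support size is extracted from the faces by inclusion-exclusion. *)
Record bij_spectrum (R : realFieldType) (n : nat) (V : finZmodType)
    (a : {ffun 'I_n -> V} -> R) : Prop := BijSpectrum {
  bs_card : #|{: V}| = n;
  bs_zero : a 0 = 1;
  bs_perm : forall (s : 'S_n) (chi : {ffun 'I_n -> V}), a [ffun i => chi (s i)] = a chi;
  bs_shift : forall v (chi : {ffun 'I_n -> V}), a [ffun i => chi i + v] = a chi;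
  bs_move : forall (chi : {ffun 'I_n -> V}) (p : 'I_n), chi p != 0 -> \sum_q a (move chi p q) = 0;
  bs_mass : forall A : {set 'I_n}, \sum_(chi | supp chi \subset A) a chi ^+ 2 =
    n%:R ^+ #|A| * (n - #|A|)`!%:R / n`!%:R;
  bs_sup : forall chi : {ffun 'I_n -> V}, a chi ^+ 2 * n`!%:R ^+ 2 * (\prod_v (occ chi v) ^ (occ chi v))%N%:R
    <= n%:R ^+ n * (\prod_v (occ chi v)`!)%N%:R ^+ 2 }.

Lemma bij_spectrum_exists (R : rcfType) (G : finZmodType) :
  (1 < #|G|)%N -> \sum_(x : G) x = 0 ->
  exists (V : finZmodType) (a : {ffun 'I_#|G| -> V} -> R), bij_spectrum a /\
    (sum_triples G)%:R = (#|G|)`!%:R ^+ 3 / #|G|%:R ^+ #|G| * \sum_chi a chi ^+ 3.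
Proof.
move=> n_gt1 sumG; have [w w_prim] := closed_prim_root_exists (R[i] : numClosedFieldType) (ltnW n_gt1).
pose c : {rmorphism R -> R[i]} := real_complex R.
have cI : injective c by apply: fmorph_inj.
pose a (chi : {ffun 'I_#|G| -> dual G}) : R := complex.Re (spec w chi).
have aE chi : c (a chi) = spec w chi.
  by apply: RRe_real; rewrite CrealE (spec_conj n_gt1 w_prim).
have le_c x y : (x <= y) = (c x <= c y) by rewrite lecR.
exists (dual G), a; split; first split.
- exact (card_dual n_gt1 w_prim).
- by apply: cI; rewrite aE spec0 rmorph1.
- by move=> s chi; apply: cI; rewrite !aE spec_perm.
- by move=> v chi; apply: cI; rewrite !aE (spec_shift n_gt1 w_prim).
- move=> chi p chip; apply: cI; rewrite rmorph_sum rmorph0 -[RHS](spec_move n_gt1 w_prim chip).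
  by apply: eq_bigr => q _; rewrite aE.
- move=> A; apply: cI; rewrite rmorph_sum !rmorphM fmorphV rmorphXn !rmorph_nat.
  rewrite -(spec_mass n_gt1 w_prim); apply: eq_bigr => chi _.
  by rewrite rmorphXn aE.
- move=> chi; rewrite le_c !rmorphM !rmorphXn !rmorph_nat aE.
  exact (spec_sup n_gt1 w_prim chi).
apply: cI; rewrite !rmorphM fmorphV !rmorphXn !rmorph_nat rmorph_sum.
rewrite (sum_triples_spec n_gt1 w_prim); congr (_ * _); apply: eq_bigr => chi _.
by rewrite rmorphXn aE.
Qed.

(** * Elementary estimates *)

Section RealBounds.
Variable R : realType.
Local Notation e := (expR 1 : R).

Lemma expR_nat (m : nat) : expR (m%:R : R) = e ^+ m.
Proof. by rewrite -[m%:R]mulr1 expRM_natl. Qed.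

Lemma e_ge1 : 1 <= e.
Proof. by apply: le_trans (expR_ge1Dx 1); rewrite lerDl. Qed.

Lemma e_pow_ge1 m : 1 <= e ^+ m.
Proof. by rewrite exprn_ege1 ?e_ge1. Qed.

Lemma expD1_le (x : R) (k : nat) : -1 <= x -> (1 + x) ^+ k <= expR (k%:R * x).
Proof.
move=> x_ge; rewrite expRM_natl lerXn2r ?nnegrE ?expR_ge0 ?expR_ge1Dx //.
by rewrite -lerBlDl sub0r.
Qed.

Lemma pow_le_shift (n m : nat) : (m <= n)%N ->
  n%:R ^+ (n - m) <= e ^+ m * (n - m)%:R ^+ (n - m) :> R.
Proof.
move=> mn; have [k ->] : exists k, n = (k + m)%N by exists (n - m)%N; rewrite subnK.
rewrite addnK; case: k => [|k]; first by rewrite !expr0 mulr1 e_pow_ge1.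
have k_gt0 : 0 < k.+1%:R :> R by rewrite ltr0n.
rewrite -ler_pdivrMr ?exprn_gt0 // -expr_div_n natrD mulrDl divff ?lt0r_neq0 //.
apply: le_trans (expD1_le _ _) _.
  by apply: (@le_trans _ _ 0); rewrite ?oppr_le0 ?divr_ge0.
by rewrite mulrCA divff ?mulr1 ?lt0r_neq0 // expR_nat.
Qed.

Lemma succ_pow_le (n m : nat) : (m <= n)%N -> n.+1%:R ^+ m <= e * n%:R ^+ m :> R.
Proof.
case: n => [|n] mn; first by move: mn; rewrite leqn0 => /eqP ->; rewrite !expr0 mulr1 e_ge1.
have n_gt0 : 0 < n.+1%:R :> R by rewrite ltr0n.
rewrite -ler_pdivrMr ?exprn_gt0 // -expr_div_n -[n.+2]addn1 natrD mulrDl divff ?lt0r_neq0 //.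
apply: le_trans (expD1_le _ _) _.
  by apply: (@le_trans _ _ 0); rewrite ?oppr_le0 ?divr_ge0.
by rewrite ler_expR mul1r ler_pdivrMr // mul1r ler_nat.
Qed.

Lemma pow_fact_le (n m : nat) : (m <= n)%N ->
  n%:R ^+ m * (n - m)`!%:R <= e ^+ m * n`!%:R :> R.
Proof.
move=> mn; have [k ->] : exists k, n = (k + m)%N by exists (n - m)%N; rewrite subnK.
rewrite addnK {n mn}; elim: m => [|m IHm]; first by rewrite addn0 !expr0.
rewrite addnS factS natrM !exprS.
have h := ler_wpM2r (ler0n R k`!) (succ_pow_le (leq_addl k m)).
have h' := ler_wpM2l (expR_ge0 (1 : R)) IHm.
rewrite mulrA in h'; have := ler_wpM2l (ler0n R (k + m).+1) (le_trans h h').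
by rewrite mulrA => /le_trans; apply; rewrite le_eqVlt; apply/orP; left; apply/eqP; ring.
Qed.

Lemma e_pow_le_succ (n : nat) : e * n%:R ^+ n.+1 <= n.+1%:R ^+ n.+1.
Proof.
have n_gt0 : 0 < n.+1%:R :> R by rewrite ltr0n.
have := @expD1_le (- n.+1%:R^-1) n.+1.
rewrite lerN2 invf_le1 // ler1n => /(_ isT).
have -> : 1 + - n.+1%:R^-1 = n%:R / n.+1%:R :> R.
  apply: (mulIf (lt0r_neq0 n_gt0)); rewrite mulfVK ?lt0r_neq0 // mulrDl mulNr.
  by rewrite mulVf ?lt0r_neq0 // mul1r -natr1 addrK.
rewrite mulrN divff ?lt0r_neq0 // expRN expr_div_n ler_pdivrMr ?exprn_gt0 //.
by rewrite ler_pdivlMl ?expR_gt0.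
Qed.

(** Stirling's upper bound up to a factor of order sqrt k. Unlike [fact_le_expn] it keeps e^k, which
    cannot be given away when all n coordinates are counted. *)
Lemma fact_le_pow (k : nat) : (0 < k)%N ->
  k`!%:R * e ^+ k <= e * k%:R * k%:R ^+ k :> R.
Proof.
elim: k => // -[|k] IHk _; first by rewrite (_ : 1`! = 1%N) // expr1 mul1r !mulr1.
rewrite factS natrM exprSr.
apply: (@le_trans _ _ (k.+2%:R * (e * (e * k.+1%:R ^+ k.+2)))); last first.
  rewrite -[X in _ <= X]mulrA [X in _ <= X]mulrCA ler_wpM2l // ler_wpM2l ?expR_ge0 //.
  exact: e_pow_le_succ.
have := ler_wpM2l (mulr_ge0 (ler0n R k.+2) (expR_ge0 1)) (IHk isT).
by rewrite !exprS => h; apply: le_trans (le_trans h _); rewrite le_eqVlt; apply/orP; left; apply/eqP; ring.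
Qed.

Lemma expn_fact_le (n : nat) : n%:R ^+ n <= e ^+ n * n`!%:R :> R.
Proof. by have := pow_fact_le (leqnn n); rewrite subnn fact0 mulr1. Qed.

End RealBounds.

Lemma fact_le_expn k : (k`! <= k ^ k)%N.
Proof.
elim: k => // k IHk; rewrite factS expnS leq_mul2l /=.
by apply: leq_trans IHk _; case: k => // k; rewrite leq_exp2r.
Qed.

(** The first two terms of the binomial expansion of (a + b)^b are b^b and a b^b. *)
Lemma merge_pow (a b : nat) : (0 < b)%N -> (a * b ^ b <= (a + b) ^ b)%N.
Proof.
case: b => // b _; have bernoulli j : (b.+1 ^ j.+1 + j.+1 * a * b.+1 ^ j <= (a + b.+1) ^ j.+1)%N.
  elim: j => [|j IHj]; first by rewrite !expn1 expn0 mul1n muln1 addnC.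
  rewrite [X in (_ <= X)%N]expnS; apply: leq_trans (leq_mul (leqnn _) IHj).
  rewrite [(b.+1 ^ j.+1)%N]expnS [(b.+1 ^ j.+2)%N]expnS [(b.+1 ^ j.+1)%N]expnS.
  by move: (b.+1 ^ j)%N => u; nia.
apply: leq_trans (bernoulli b); apply: leq_trans (leq_addl _ _).
by rewrite expnS -mulnA mulnCA.
Qed.

(* Merging positive values one by one costs a factor equal to the total each time. *)
Lemma prod_selfpow_le (I : finType) (P : pred I) (f : I -> nat) :
  let s := (\sum_(i | P i) f i)%N in
  (0 < s -> \prod_(i | P i) f i ^ f i * s ^ #|[set i | P i & 0 < f i]| <= s ^ s.+1)%N.
Proof.
move=> s s_gt0; pose r := [seq i <- index_enum I | P i && (0 < f i)%N].
have main (l : seq I) : all (fun i => 0 < f i)%N l -> let t := (\sum_(i <- l) f i)%N in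
    (size l <= t)%N /\ (0 < t -> \prod_(i <- l) f i ^ f i * t ^ size l <= t ^ t.+1)%N.
  elim: l => [|i l IHl] /=; first by rewrite !big_nil.
  move=> /andP[fi /IHl[le_t IH]]; rewrite !big_cons.
  move: IH le_t; set t := (\sum_(j <- l) f j)%N; set p := (\prod_(j <- l) _)%N => IH le_t.
  split=> [|_]; first by rewrite -add1n leq_add.
  have [t0|t_gt0] := posnP t.
    have l0 : size l = 0%N by apply/eqP; rewrite -leqn0 -t0.
    by rewrite /p (size0nil l0) big_nil muln1 t0 addn0 expn1 -expnSr.
  have p_le : (p <= t * t ^ (t - size l))%N.
    rewrite -(leq_pmul2r (m := t ^ size l)) ?expn_gt0 ?t_gt0 //.
    by rewrite -mulnA -expnD subnK // -expnS IH.
  have -> : (f i + t).+1 = (f i + (t - size l) + (size l).+1)%N by lia.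
  rewrite expnD leq_mul2r; apply/orP; right; rewrite expnD.
  apply: (@leq_trans (f i ^ f i * (t * t ^ (t - size l)))); first by rewrite leq_mul2l p_le orbT.
  rewrite mulnA; apply: leq_mul; last first.
    by case: (t - size l)%N => // j; rewrite leq_exp2r // leq_addl.
  by rewrite mulnC [X in (_ <= X ^ _)%N]addnC merge_pow.
have rE : (\prod_(i | P i) f i ^ f i = \prod_(i <- r) f i ^ f i)%N.
  rewrite big_filter_cond [LHS]big_mkcond [RHS]big_mkcond /=; apply: eq_bigr => i _.
  by case: (P i) => //=; case: (f i).
have sE : s = (\sum_(i <- r) f i)%N.
  rewrite big_filter_cond /s [LHS]big_mkcond [RHS]big_mkcond /=; apply: eq_bigr => i _.
  by case: (P i) => //=; case: (f i).
have cE : #|[set i | P i & (0 < f i)%N]| = size r by rewrite cardsE cardE.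
have [|_] := main r; first by apply/allP => i; rewrite mem_filter => /andP[/andP[]].
by rewrite rE cE -sE; apply.
Qed.

(** * Summation over colour multiplicities *)

Section TypeCount.
Variables (R : realType) (N : nat) (W : finType).
Implicit Types (chi : {ffun 'I_N -> W}).

Lemma occ_le chi v : (occ chi v <= N)%N.
Proof. by rewrite -[X in (_ <= X)%N](sum_occ chi) (bigD1 v) //= leq_addr. Qed.

Definition occ_type chi : {ffun W -> 'I_N.+1} := [ffun v => inord (occ chi v)].

Lemma occ_typeE chi v : occ_type chi v = occ chi v :> nat.
Proof. by rewrite ffunE inordK // ltnS occ_le. Qed.

(** In the expansion of N^N as the N-th power of the sum of nu, each colouring of type nu
    contributes the product of the nu^nu. *)
Lemma card_occ_type_le (nu : {ffun W -> 'I_N.+1}) :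
  (\sum_(chi | occ_type chi == nu) \prod_v (nu v)%:R ^+ nu v <= N%:R ^+ N :> R).
Proof.
have prod_ge0 chi : 0 <= \prod_v (nu v)%:R ^+ occ chi v :> R.
  by apply: prodr_ge0 => v _; rewrite exprn_ge0.
have [chi0 /eqP nuE|none] := pickP (fun chi => occ_type chi == nu); last first.
  rewrite [X in X <= _]big_pred0; last exact: none.
  by rewrite exprn_ge0 ?ler0n.
have -> : N%:R ^+ N = \sum_(chi : {ffun 'I_N -> W}) \prod_v (nu v)%:R ^+ occ chi v :> R.
  have -> : N%:R ^+ N = \prod_(i < N) \sum_v (nu v)%:R :> R.
    rewrite prodr_const card_ord -natr_sum; congr (_%:R ^+ _).
    by rewrite -[LHS](sum_occ chi0); apply: eq_bigr => v _; rewrite -nuE occ_typeE.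
  rewrite bigA_distr_bigA; apply: eq_bigr => chi _.
  by rewrite -(prod_occ chi (fun v => (nu v)%:R)).
rewrite [X in X <= _]big_mkcond; apply: ler_sum => chi _; case: ifP => // /eqP <-.
by under eq_bigr do rewrite {2}occ_typeE.
Qed.

(* There are at most N^N / prod nu^nu colourings with colour multiplicities nu, and the weights h majorize
   the sum over all nu by a product over colours. *)
Lemma sum_le_type_weights (P : pred {ffun 'I_N -> W}) (f : {ffun 'I_N -> W} -> R)
    (h : W -> nat -> R) (B : R) :
  (0 < N)%N -> 0 <= B -> (forall v k, 0 <= h v k) ->
  (forall chi, P chi -> f chi * N%:R ^+ N <=
     B * (\prod_v h v (occ chi v)) * \prod_v (occ chi v)%:R ^+ occ chi v) ->
  \sum_(chi | P chi) f chi <= B * \prod_v \sum_(k < N.+1) h v k.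
Proof.
move=> N_gt0 B_ge0 h_ge0 f_le.
have NN_gt0 : 0 < N%:R ^+ N :> R by rewrite exprn_gt0 ?ltr0n.
rewrite -(ler_pM2r NN_gt0) mulr_suml; apply: le_trans (ler_sum _ f_le) _.
have F_ge0 chi : 0 <= B * (\prod_v h v (occ chi v)) * \prod_v (occ chi v)%:R ^+ occ chi v.
  by rewrite !mulr_ge0 ?prodr_ge0 // => v _; rewrite exprn_ge0.
apply: (@le_trans _ _ (\sum_chi B * (\prod_v h v (occ chi v)) * \prod_v (occ chi v)%:R ^+ occ chi v)).
  by rewrite [X in X <= _]big_mkcond; apply: ler_sum => chi _; case: ifP.
rewrite bigA_distr_bigA mulr_sumr mulr_suml (partition_big occ_type predT) //=.
apply: ler_sum => nu _.
have -> : \sum_(chi | occ_type chi == nu)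
      B * (\prod_v h v (occ chi v)) * (\prod_v (occ chi v)%:R ^+ occ chi v) =
    (B * \prod_v h v (nu v)) * \sum_(chi | occ_type chi == nu) \prod_v (nu v)%:R ^+ nu v.
  rewrite mulr_sumr; apply: eq_bigr => chi /eqP <-.
  by congr (_ * _ * _); apply: eq_bigr => v _; rewrite occ_typeE.
by rewrite ler_wpM2l ?card_occ_type_le // mulr_ge0 // prodr_ge0.
Qed.

End TypeCount.

(** * The pointwise bound for small support and for all coordinates together *)

Section SupBounds.
Variables (R : realType) (n : nat) (V : finZmodType) (a : {ffun 'I_n -> V} -> R).
Hypothesis a_spec : bij_spectrum a.
Local Notation freq := {ffun 'I_n -> V}.
Local Notation e := (expR 1 : R).
Implicit Type chi : freq.

Lemma occ0_supp chi : (occ chi 0%R + #|supp chi| = n)%N.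
Proof.
rewrite -[RHS](etrans (cardsC (supp chi)) (card_ord n)) addnC; congr (_ + _)%N.
by apply: eq_card => i; rewrite !inE negbK.
Qed.

Lemma supp_le chi : (#|supp chi| <= n)%N.
Proof. by rewrite -[X in (_ <= X)%N](occ0_supp chi) leq_addl. Qed.

Lemma occ0E chi : occ chi 0 = (n - #|supp chi|)%N.
Proof. by rewrite -[X in (X - _)%N](occ0_supp chi) addnK. Qed.

Lemma sum_occ_neq0 chi : (\sum_(v | v != 0%R) occ chi v = #|supp chi|)%N.
Proof.
by apply/eqP; rewrite -(eqn_add2l (occ chi 0)) occ0_supp -[X in _ == X](sum_occ chi) [X in _ == X](bigD1 0).
Qed.

Definition selfpow chi := (\prod_(v | v != 0%R) occ chi v ^ occ chi v)%N.

Lemma selfpow_gt0 chi : (0 < selfpow chi)%N.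
Proof. by apply: prodn_gt0 => v; case: (occ chi v) => // k; rewrite expn_gt0. Qed.

Lemma prod_selfpow chi : (\prod_v occ chi v ^ occ chi v =
  (n - #|supp chi|) ^ (n - #|supp chi|) * selfpow chi)%N.
Proof. by rewrite (bigD1 0) //= occ0E. Qed.

Definition ncolours chi := #|[set v | v != 0 & (0 < occ chi v)%N]|.

Lemma selfpow_ncolours chi : (0 < #|supp chi|)%N ->
  (selfpow chi * #|supp chi| ^ ncolours chi <= #|supp chi| ^ #|supp chi|.+1)%N.
Proof. by move=> m_gt0; have := @prod_selfpow_le _ (fun v => v != 0) (occ chi); rewrite /= sum_occ_neq0 => /(_ m_gt0). Qed.

Lemma selfpow_le chi : (selfpow chi <= #|supp chi| ^ #|supp chi|)%N.
Proof.
rewrite -[X in (_ <= _ ^ X)%N]sum_occ_neq0 expn_sum; apply: leq_prod => v v0.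
case E : (occ chi v) => [//|k]; rewrite leq_exp2r // -E -sum_occ_neq0.
by rewrite (bigD1 v) //= leq_addr.
Qed.

(** The trivial character keeps its factorial, since only losses exponential in m are affordable;
    the other characters use k! <= k^k. One e^m pays for n^(n - m) against (n - m)^(n - m), and
    e^(2m) for the square of n^m (n - m)! against n!. *)
Lemma sup_supp chi : a chi ^+ 2 * n%:R ^+ #|supp chi| <= e ^+ (3 * #|supp chi|) * (selfpow chi)%:R.
Proof.
have := bs_sup a_spec chi; rewrite prod_selfpow; have := supp_le chi.
have := selfpow_gt0 chi.
have : (\prod_v (occ chi v)`! <= (n - #|supp chi|)`! * selfpow chi)%N.
  by rewrite (bigD1 0) //= occ0E leq_mul2l leq_prod ?orbT // => v _; rewrite fact_le_expn.
move: (selfpow chi) (\prod_v _)%N (a chi) #|supp chi| => q p x m p_le q_gt0 m_le x_le.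
have pos1 : 0 < (n - m)%:R ^+ (n - m) :> R by case: (n - m)%N => [|k]; rewrite ?expr0 ?exprn_gt0 ?ltr0n.
have f_gt0 : 0 < n`!%:R :> R by rewrite ltr0n fact_gt0.
have q_pos : 0 < q%:R :> R by rewrite ltr0n.
have p_le' : p%:R <= (n - m)`!%:R * q%:R :> R by rewrite -natrM ler_nat.
have h1 : x ^+ 2 * n`!%:R ^+ 2 * (n - m)%:R ^+ (n - m) <= n%:R ^+ n * (n - m)`!%:R ^+ 2 * q%:R.
  rewrite natrM natrX mulrA in x_le; rewrite -(ler_pM2r q_pos); apply: le_trans x_le _.
  rewrite -!mulrA ler_wpM2l ?exprn_ge0 // mulrA -expr2 -exprMn.
  by rewrite lerXn2r ?nnegrE ?mulr_ge0.
have h2 := pow_fact_le R m_le.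
have h3 : (n%:R ^+ m * (n - m)`!%:R) ^+ 2 <= (e ^+ m * n`!%:R) ^+ 2 :> R.
  by rewrite lerXn2r ?nnegrE ?mulr_ge0 ?exprn_ge0 ?expR_ge0.
have h4 := pow_le_shift R m_le.
have nm_ge0 : 0 <= n%:R ^+ m :> R by rewrite exprn_ge0.
have := ler_wpM2r (exprn_ge0 2 nm_ge0) h1.
have E1 : n%:R ^+ n = n%:R ^+ m * n%:R ^+ (n - m) :> R by rewrite -exprD subnKC.
set N := n%:R ^+ m in h2 h3 nm_ge0 E1 *; set D := (n - m)%:R ^+ (n - m) in pos1 h1 h4 *.
set f := n`!%:R in f_gt0 h1 h2 h3 *; set g := (n - m)`!%:R in h1 h2 h3 *.
have -> : e ^+ (3 * m) = (e ^+ m) ^+ 3 by rewrite -exprM mulnC.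
set E := e ^+ m in h2 h3 h4 *; rewrite E1; set Q := n%:R ^+ (n - m) in h4 E1 *.
have [n0|n_gt0] := posnP n.
  have m0 : m = 0%N by move: m_le; rewrite n0 leqn0 => /eqP.
  have f1 : f = 1 by rewrite /f n0.
  have N1 : N = 1 by rewrite /N m0.
  have D1 : D = 1 by rewrite /D n0 m0.
  have Q1 : Q = 1 by rewrite /Q n0 m0.
  have E1' : E = 1 by rewrite /E m0.
  have g1 : g = 1 by rewrite /g n0 m0.
  by move: h1; rewrite E1 f1 N1 D1 Q1 E1' g1 => h1 _; lra.
have N_gt0 : 0 < N by rewrite exprn_gt0 ?ltr0n.
move=> h5.
have h6 : x ^+ 2 * f ^+ 2 * D * N ^+ 2 <= N * Q * q%:R * (E * f) ^+ 2.
  apply: le_trans h5 _; rewrite [X in X <= _](_ : _ = N * Q * q%:R * (N * g) ^+ 2); last by ring.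
  by rewrite ler_wpM2l // !mulr_ge0 // exprn_ge0.
have h7 : x ^+ 2 * f ^+ 2 * D * N ^+ 2 <= N * (E * D) * q%:R * (E * f) ^+ 2.
  by apply: le_trans h6 _; rewrite ler_wpM2r ?sqr_ge0 // ler_wpM2r ?(ltW q_pos) // ler_wpM2l.
have c_gt0 : 0 < f ^+ 2 * D * N by rewrite (mulr_gt0 (mulr_gt0 (exprn_gt0 2 f_gt0) pos1) N_gt0).
rewrite -(ler_pM2r c_gt0); apply: le_trans (le_trans _ h7) _; rewrite le_eqVlt; apply/orP; left; apply/eqP; ring.
Qed.

Definition all_colours chi := #|[set v | (0 < occ chi v)%N]|.

(** The loss e k of [fact_le_pow] in each colour is absorbed by e x <= exp x at x = d k. The price
    is 1/d for each colour that occurs and exp(d n) overall; d stays free to balance the two. *)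
Lemma sup_all (d : R) chi : 0 < d -> a chi ^+ 2 * n%:R ^+ n <=
  (d ^- all_colours chi * expR (d * n%:R)) ^+ 2 * (\prod_v occ chi v ^ occ chi v)%N%:R.
Proof.
move=> d_gt0; have := bs_sup a_spec chi.
have h : (\prod_v (occ chi v)`!)%N%:R * e ^+ n <=
    d ^- all_colours chi * expR (d * n%:R) * (\prod_v occ chi v ^ occ chi v)%N%:R.
  have -> : d ^- all_colours chi = \prod_v (if (0 < occ chi v)%N then d^-1 else 1).
    rewrite -big_mkcond /= -exprVn -prodr_const; apply: eq_bigl => v.
    by rewrite inE.
  have -> : expR (d * n%:R) = \prod_v expR (d * (occ chi v)%:R).
    by rewrite -expR_sum -mulr_sumr -natr_sum sum_occ.
  rewrite -[in e ^+ n](sum_occ chi) expr_sum !natr_prod -!big_split /=.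
  apply: ler_prod => v _; rewrite mulr_ge0 ?exprn_ge0 ?expR_ge0 //=.
  case E : (occ chi v) => [|k] /=; first by rewrite mulr0 expR0 !mul1r expn0.
  apply: le_trans (fact_le_pow R (ltn0Sn k)) _; rewrite natrX ler_wpM2r ?exprn_ge0 //.
  rewrite ler_pdivlMl // mulrCA mulrC.
  by have := expR_ge1Dx (d * k.+1%:R - 1); rewrite addrCA subrr addr0 expRB ler_pdivlMr ?expR_gt0.
have h' := expn_fact_le R n.
have P_gt0 : 0 < (\prod_v occ chi v ^ occ chi v)%N%:R :> R.
  by rewrite ltr0n prodn_gt0 // => v; case: (occ chi v) => // k; rewrite expn_gt0.
have n_gt0 : 0 < n%:R ^+ n :> R by case: (n) => [|k]; rewrite ?expr0 ?exprn_gt0 ?ltr0n.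
move: h h' P_gt0 n_gt0; move: (\prod_v (occ chi v)`!)%N%:R (ler0n R (\prod_v (occ chi v)`!)%N) => F F_ge0.
move: (\prod_v _)%N%:R (d ^- _ * _) (a chi) (n%:R ^+ n) n`!%:R (ler0n R n`!) => P D x N f f_ge0.
have := exprn_ge0 n (expR_ge0 (1 : R)); move: (e ^+ n) => E E_ge0 h h' P_gt0 N_gt0 x_le.
have h1 : (F * E) ^+ 2 <= (D * P) ^+ 2.
  have FE_ge0 : 0 <= F * E by rewrite mulr_ge0.
  by rewrite lerXn2r ?nnegrE // (le_trans FE_ge0).
have h2 : N ^+ 2 <= (E * f) ^+ 2 by rewrite lerXn2r ?nnegrE ?mulr_ge0 // ltW.
have h3 := ler_wpM2r (exprn_ge0 2 E_ge0) x_le.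
have h4 := ler_wpM2l (mulr_ge0 (sqr_ge0 x) (ltW P_gt0)) h2.
have h5 := ler_wpM2l (ltW N_gt0) h1.
rewrite -(ler_pM2r N_gt0) -(ler_pM2r P_gt0); nra.
Qed.

End SupBounds.

(** * Mass of the sparse part *)

Section DifferenceTable.
Variable R : realType.

Fixpoint diff_table (u : nat -> R) (m j : nat) : R :=
  if m is m'.+1 then diff_table u m' j.+1 - diff_table u m' j else u j.

Variables (n : nat) (u : nat -> R).
Hypothesis u_rec : forall j, (j < n)%N -> (n%:R - j%:R) * u j.+1 = n%:R * u j.
Local Notation d := (diff_table u).

(** The hypothesis says that n times the first difference of u at j is j u(j + 1). Taking m further
    differences with the Leibniz rule for the factor j gives both terms. For m = 0 the entry at
    [m.-1] is multiplied by 0. *)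
Lemma diff_table_rec m j : (m.+1 + j <= n)%N ->
  n%:R * d m.+1 j = j%:R * d m j.+1 + m%:R * d m.-1 j.+2.
Proof.
elim: m j => [|m IHm] j le_n.
  by rewrite mul0r addr0 /= mulrBr -(u_rec (j := j)) //; ring.
have -> : n%:R * d m.+2 j = n%:R * d m.+1 j.+1 - n%:R * d m.+1 j by rewrite -mulrBr.
rewrite !IHm; [|lia|lia].
case: m {IHm le_n} => [|m] /=; rewrite -!natr1; ring.
Qed.

(** At j = 0 the first term of [diff_table_rec] vanishes, and the shift by 2 is expanded as the
    square of identity plus difference. *)
Lemma diff_table_rec0 m : (m.+2 <= n)%N ->
  (n%:R - m.+1%:R) * d m.+2 0 = 2 * m.+1%:R * d m.+1 0 + m.+1%:R * d m 0.
Proof.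
move=> le_n; have := @diff_table_rec m.+1 0; rewrite addn0 => /(_ le_n).
rewrite mul0r add0r [m.+1.-1]/= => h.
rewrite mulrBl h.
have -> : d m.+2 0 = d m 2 - d m 1 - (d m 1 - d m 0) by [].
have -> : d m.+1 0 = d m 1 - d m 0 by [].
ring.
Qed.

Lemma diff_table_10 : (0 < n)%N -> d 1 0 = 0.
Proof.
move=> n_gt0; have := @diff_table_rec 0 0; rewrite addn0 => /(_ n_gt0).
by rewrite !mul0r addr0 => /eqP; rewrite mulf_eq0 pnatr_eq0 eqn0Ngt n_gt0 => /eqP.
Qed.

End DifferenceTable.

Section Mass.
Variables (R : realType) (n : nat) (V : finZmodType) (a : {ffun 'I_n -> V} -> R).
Hypothesis a_spec : bij_spectrum a.
Local Notation freq := {ffun 'I_n -> V}.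
Implicit Types (chi : freq) (A B : {set 'I_n}).

Definition face_mass (j : nat) : R := n%:R ^+ j * (n - j)`!%:R / n`!%:R.
Local Notation d := (diff_table face_mass).

Lemma face_mass_rec j : (j < n)%N -> (n%:R - j%:R) * face_mass j.+1 = n%:R * face_mass j.
Proof.
move=> jn; rewrite /face_mass -natrB 1?ltnW // -[in (n - j)`!](subnSK jn) factS subnSK //.
by rewrite natrM exprS; ring.
Qed.

(** Demanding x in the support means the sum with x allowed minus the sum with x forbidden. This
    moves x out of A and is one step of the difference table, which starts from [bs_mass] at A
    empty. *)
Lemma sandwich_mass A B : [disjoint A & B] ->
  \sum_(chi | (A \subset supp chi) && (supp chi \subset A :|: B)) a chi ^+ 2 = d #|A| #|B|.
Proof.
move Dm: #|A| => m; elim: m A B Dm => [|m IHm] A B Dm dAB /=.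
  rewrite (cards0_eq Dm) set0U -[RHS](bs_mass a_spec B).
  by apply: eq_bigl => chi; rewrite sub0set.
have [x xA] : exists x, x \in A by apply/set0Pn; rewrite -card_gt0 Dm.
have cA : #|A :\ x| = m by move: Dm; rewrite (cardsD1 x) xA add1n => -[].
have xB : x \notin B by move/pred0P: dAB => /(_ x) /=; rewrite xA => /negbT.
have d1 : [disjoint A :\ x & x |: B].
  apply/pred0P => y /=; rewrite !inE; have /pred0P/(_ y) /= := dAB.
  by case: (y == x); case: (y \in A); case: (y \in B).
have d2 : [disjoint A :\ x & B] by apply: disjointWl dAB; rewrite subsetDl.
have := IHm (A :\ x) (x |: B) cA d1; rewrite cardsU1 xB add1n => <-.
rewrite -(IHm (A :\ x) B cA d2) [in RHS](bigID (fun chi => x \in supp chi)) /=.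
rewrite -addrA [X in _ + X](_ : _ = 0) ?addr0.
  apply: eq_bigl => chi; rewrite [in LHS](_ : A :|: B = (A :\ x) :|: (x |: B)); last first.
    by apply/setP => y; rewrite !inE; case: eqP => // ->; rewrite xA !orbT.
  by rewrite -{1}(setD1K xA) subUset sub1set -andbA andbC.
apply/eqP; rewrite subr_eq0; apply/eqP; apply: eq_bigl => chi.
rewrite -andbA; congr (_ && _); apply/andP/idP => [[/subsetP h xN]|/subsetP h].
  apply/subsetP => y ys; have := h y ys; rewrite !inE.
  by case: eqP ys xN => [-> ->|_ _ _] //=; rewrite orbF.
split; first by apply/subsetP => y /h; rewrite !inE => /orP[->//|->]; rewrite !orbT.
by apply/negP => /h; rewrite !inE eqxx /= (negPf xB).
Qed.

Definition mass m := \sum_(chi | #|supp chi| == m) a chi ^+ 2.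

Lemma mass_ge0 m : 0 <= mass m.
Proof. by apply: sumr_ge0 => chi _; apply: sqr_ge0. Qed.

Lemma massE m : mass m = 'C(n, m)%:R * d m 0.
Proof.
rewrite /mass (partition_big (@supp V n) (fun A => #|A| == m)) //=.
rewrite (eq_bigr (fun=> d m 0)) => [|A /eqP cA].
  by rewrite sumr_const -[X in _ *+ X](eq_card (A := [set A : {set 'I_n} | #|A| == m])) ?card_draws ?card_ord ?mulr_natl // => A; rewrite inE.
have := @sandwich_mass A set0; rewrite cA cards0 setU0 => <-; last by rewrite -setI_eq0 setI0.
apply: eq_bigl => chi; rewrite -eqEsubset [A == _]eq_sym andb_idl // => /eqP ->.
by rewrite cA.
Qed.

Lemma mass_gt_n m : (n < m)%N -> mass m = 0.
Proof. by move=> nm; rewrite massE bin_small // mul0r. Qed.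

Lemma mass_rec m : (m.+2 <= n)%N ->
  m.+2%:R * mass m.+2 = 2 * m.+1%:R * mass m.+1 + (n%:R - m%:R) * mass m.
Proof.
move=> mn; have h := diff_table_rec0 face_mass_rec mn.
have b1 : m.+2%:R * 'C(n, m.+2)%:R = (n%:R - m.+1%:R) * 'C(n, m.+1)%:R :> R.
  by rewrite -natrB 1?ltnW // -!natrM mul_bin_left.
have b2 : m.+1%:R * 'C(n, m.+1)%:R = (n%:R - m%:R) * 'C(n, m)%:R :> R.
  by rewrite -natrB ?mul_bin_left -?natrM ?mul_bin_left //; lia.
rewrite !massE mulrA b1 mulrAC h mulrDl; congr (_ + _); first by ring.
by rewrite mulrAC b2; ring.
Qed.

Lemma mass0 : mass 0 = 1.
Proof. 
rewrite massE bin0 mul1r /= /face_mass expr0 mul1r subn0 divff //.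
by rewrite pnatr_eq0 -lt0n fact_gt0.
Qed.

Lemma mass1 : mass 1 = 0.
Proof.
have [n0|n_gt0] := posnP n; first by rewrite mass_gt_n // n0.
by rewrite massE (diff_table_10 face_mass_rec) ?mulr0.
Qed.

(** The term (n - m) [mass m] of [mass_rec] dictates the scale s(m) = sqrt(n^m / m!), because s(m) n
    / (m + 2) <= s(m + 2); the base 3 works because 2 * 3 + 1 <= 3^2. Above n the mass is 0. *)
Lemma mass_bound m : mass m <= 3 ^+ m * Num.sqrt (n%:R ^+ m / m`!%:R).
Proof.
have s_ge0 k : 0 <= Num.sqrt (n%:R ^+ k / k`!%:R) :> R by apply: sqrtr_ge0.
suff [] : mass m <= 3 ^+ m * Num.sqrt (n%:R ^+ m / m`!%:R) /\
  mass m.+1 <= 3 ^+ m.+1 * Num.sqrt (n%:R ^+ m.+1 / m.+1`!%:R) by [].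
elim: m => [|m [IH1 IH2]].
  rewrite mass0 mass1 expr0 mul1r fact0 divr1 sqrtr1; split=> //.
  by rewrite mulr_ge0 ?exprn_ge0.
split=> //; have [mn|nm] := leqP m.+2 n; last first.
  by rewrite mass_gt_n // mulr_ge0 ?exprn_ge0.
pose s k : R := Num.sqrt (n%:R ^+ k / k`!%:R).
have n_gt0 : 0 < n%:R :> R by rewrite ltr0n; lia.
have m1_gt0 : 0 < m.+1%:R :> R by rewrite ltr0n.
have m2_gt0 : 0 < m.+2%:R :> R by rewrite ltr0n.
have le_n : m.+2%:R <= n%:R :> R by rewrite ler_nat.
have q_ge0 k : 0 <= n%:R ^+ k / k`!%:R :> R by rewrite divr_ge0 ?exprn_ge0.
have qS k : n%:R ^+ k.+1 / k.+1`!%:R = n%:R ^+ k / k`!%:R * (n%:R / k.+1%:R) :> R.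
  by rewrite factS natrM exprSr invfM [X in _ * X = _]mulrC mulrACA.
have s1 : s m.+1 <= s m.+2.
  apply: ler_wsqrtr; rewrite [X in _ <= X]qS ler_peMr // ler_pdivlMr // mul1r //.
have s2 : s m * (n%:R / m.+2%:R) <= s m.+2.
  have r_ge0 : 0 <= n%:R / m.+2%:R :> R by rewrite divr_ge0.
  rewrite -[n%:R / m.+2%:R]ger0_norm // -sqrtr_sqr -sqrtrM //.
  apply: ler_wsqrtr; rewrite !qS -mulrA ler_wpM2l // expr2 ler_wpM2r //.
  by rewrite ler_wpM2l // ler_pV2 ?ler_nat // inE unitfE ?lt0r_neq0.
have p_ge0 : 0 <= 3 ^+ m :> R by rewrite exprn_ge0.
rewrite -/(s m.+2) -(ler_pM2l m2_gt0) mass_rec //.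
have e1 : 2 * m.+1%:R * mass m.+1 <= m.+2%:R * (2 * 3 ^+ m.+1 * s m.+2).
  have : mass m.+1 <= 3 ^+ m.+1 * s m.+2.
    by apply: le_trans IH2 _; rewrite ler_wpM2l ?exprn_ge0.
  rewrite -[2 * 3 ^+ _ * _]mulrA -[2 * m.+1%:R * _]mulrA => h.
  rewrite [X in _ <= X](_ : _ = 2 * (m.+2%:R * (3 ^+ m.+1 * s m.+2))); last by ring.
  by rewrite ler_wpM2l // ler_pM ?mass_ge0 // ler_nat.
have e2 : (n%:R - m%:R) * mass m <= m.+2%:R * (3 ^+ m * s m.+2).
  apply: (@le_trans _ _ (n%:R * (3 ^+ m * s m))).
    by apply: ler_pM => //; rewrite ?mass_ge0 ?subr_ge0 ?gerBl ?ler_nat ?(ltnW (ltnW mn)).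
  have := ler_wpM2l (mulr_ge0 p_ge0 (ltW m2_gt0)) s2.
  have -> : 3 ^+ m * m.+2%:R * (s m * (n%:R / m.+2%:R)) = n%:R * (3 ^+ m * s m) * (m.+2%:R / m.+2%:R).
    by ring.
  rewrite divff ?lt0r_neq0 // mulr1 => /le_trans; apply.
  by rewrite le_eqVlt; apply/orP; left; apply/eqP; ring.
apply: le_trans (lerD e1 e2) _; rewrite -mulrDr ler_wpM2l ?(ltW m2_gt0) //.
rewrite !exprS -mulrDl ler_wpM2r ?s_ge0 //.
move: (3 ^+ m) p_ge0 => p p_ge0; lra.
Qed.

End Mass.

(** * Sparse minor arcs *)

Lemma norm_cube (R : realDomainType) (x : R) : `|x| ^+ 3 = `|x| * x ^+ 2.
Proof. by rewrite exprS real_normK ?num_real. Qed.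

Section Sparse.
Variables (R : realType) (n : nat) (V : finZmodType) (a : {ffun 'I_n -> V} -> R).
Hypothesis a_spec : bij_spectrum a.
Hypothesis n_gt0 : (0 < n)%N.
Local Notation freq := {ffun 'I_n -> V}.
Local Notation e := (expR 1 : R).
Implicit Types (chi : freq).

Lemma natr_pos : 0 < n%:R :> R. Proof. by rewrite ltr0n. Qed.
Lemma natrX_gt0 k : 0 < n%:R ^+ k :> R. Proof. by rewrite exprn_gt0 // natr_pos. Qed.

Lemma geometric_half k : \sum_(j < k) 2^-1 ^+ j.+1 <= 1 :> R.
Proof.
suff -> : \sum_(j < k) 2^-1 ^+ j.+1 = 1 - 2^-1 ^+ k :> R by rewrite gerBl exprn_ge0 ?invr_ge0.
elim: k => [|k IHk]; first by rewrite big_ord0 expr0 subrr.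
rewrite big_ord_recr /= IHk exprS; move: (2^-1 ^+ k) => u. lra.
Qed.

(** Meant for A = |a(chi)|: one factor is bounded by Z and the other two by the square estimate, so
    that the product of the nu^nu survives for [sum_le_type_weights]. *)
Lemma cube_bound (A N D E E3 q Q Z : R) :
  0 <= A -> 0 <= N -> 0 <= D -> 0 <= E -> A <= Z -> A ^+ 2 * N <= E3 * q -> Q <= E * D ->
  A ^+ 3 * (N * Q) <= Z * E * E3 * (D * q).
Proof.
move=> A_ge0 N_ge0 D_ge0 E_ge0 A_le A2_le Q_le.
apply: (@le_trans _ _ (A ^+ 3 * (N * (E * D)))).
  by rewrite ler_wpM2l ?exprn_ge0 // ler_wpM2l.
have -> : A ^+ 3 * (N * (E * D)) = A * (A ^+ 2 * N * (E * D)) by ring.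
have ED_ge0 : 0 <= E * D by rewrite mulr_ge0.
have h := ler_wpM2r ED_ge0 A2_le.
have -> : Z * E * E3 * (D * q) = Z * (E3 * q * (E * D)) by ring.
by apply: ler_pM => //; rewrite mulr_ge0 // mulr_ge0 // exprn_ge0.
Qed.

(** The supremum is at most (e^2 z^2)^m. The weights cost (2/z)^m, because there are at most m/4
    colours with z^4 each, so a factor z^m remains; the powers of e collect the losses of
    [sup_supp], [pow_le_shift] and the weights. *)
Lemma sum_few_colours (m : nat) (z : R) :
  (m <= n)%N -> 0 < z <= 1 -> z ^+ 4 = m%:R / n%:R ->
  \sum_(chi | (#|supp chi| == m) && (4 * ncolours chi <= m)%N) `|a chi| ^+ 3 <= (2 * e ^+ 7 * z) ^+ m.
Proof.
move=> mn /andP[z_gt0 z_le1] z4.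
(* The trivial colour is forced to multiplicity n - m. Any other colour has total weight at most 1 +
   z^4 = 1 + m/n, so that all n colours together give at most e^m. *)
pose h (v : V) (k : nat) : R :=
  if v == 0 then (k == (n - m)%N)%:R else 2^-1 ^+ k * (if (0 < k)%N then z ^+ 4 else 1).
have z_ge0 := ltW z_gt0.
have z4_ge0 : 0 <= z ^+ 4 by rewrite exprn_ge0.
have h_ge0 v k : 0 <= h v k.
  rewrite /h; case: ifP => _; first exact: ler0n.
  by rewrite mulr_ge0 ?exprn_ge0 // ?invr_ge0 //; case: ifP.
have e_ge0 : 0 <= e by apply: expR_ge0.
have B_ge0 : 0 <= (2 * e ^+ 6 * z) ^+ m by rewrite exprn_ge0 // !mulr_ge0 // exprn_ge0.
have -> : (2 * e ^+ 7 * z) ^+ m = (2 * e ^+ 6 * z) ^+ m * e ^+ m.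
  by rewrite -exprMn; congr (_ ^+ _); ring.
apply: le_trans (sum_le_type_weights n_gt0 B_ge0 h_ge0 _) _; last first.
  rewrite ler_wpM2l //; apply: (@le_trans _ _ (\prod_(v : V) (1 + z ^+ 4))).
    apply: ler_prod => v _; apply/andP; split; first by apply: sumr_ge0.
    rewrite /h; have [v0|v0] := eqVneq v 0.
      have nm_lt : (n - m < n.+1)%N by rewrite ltnS leq_subr.
      rewrite (bigD1 (Ordinal nm_lt)) //= eqxx big1 ?addr0 ?lerDl // => k.
      by rewrite -val_eqE /= => /negPf ->.
    rewrite big_ord_recl /= expr0 !mulr1 lerD2l.
    rewrite -[X in _ <= X]mul1r; apply: le_trans (ler_wpM2r z4_ge0 (geometric_half n)).
    by rewrite mulr_suml; apply: ler_sum => k _.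
  rewrite prodr_const (bs_card a_spec); apply: le_trans (expD1_le _ _) _.
    by apply: (@le_trans _ _ 0); rewrite // oppr_le0.
  by rewrite z4 mulrCA divff ?mulr1 ?expR_nat // gt_eqF // natr_pos.
move=> chi /andP[/eqP cm t_le].
have hE : (2^-1 * z) ^+ m <= \prod_v h v (occ chi v).
  rewrite (bigD1 0) //= {1}/h eqxx occ0E cm eqxx mul1r.
  rewrite (eq_bigr (fun v => 2^-1 ^+ occ chi v * (if (0 < occ chi v)%N then z ^+ 4 else 1))); last first.
    by move=> v /negPf v0; rewrite /h v0.
  rewrite big_split /= -expr_sum sum_occ_neq0 cm exprMn ler_wpM2l ?exprn_ge0 ?invr_ge0 //.
  rewrite -big_mkcondr /= prodr_const.
  have -> : #|[pred v | (v != 0) && (0 < occ chi v)%N]| = ncolours chi.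
    by apply: eq_card => v; rewrite !inE.
  by rewrite -exprM ler_wiXn2l.
have := sup_supp a_spec chi; have := selfpow_le chi; rewrite cm => q_le A_le.
have PE : \prod_v (occ chi v)%:R ^+ occ chi v = (n - m)%:R ^+ (n - m) * (selfpow chi)%:R :> R.
  by rewrite -cm -natrX -natrM -prod_selfpow natr_prod; apply: eq_bigr => v _; rewrite natrX.
have P_ge0 : 0 <= \prod_v (occ chi v)%:R ^+ occ chi v :> R.
  by apply: prodr_ge0 => v _; rewrite exprn_ge0.
have q_le' : (selfpow chi)%:R <= m%:R ^+ m :> R by rewrite -natrX ler_nat.
have em_ge0 k : 0 <= e ^+ k by rewrite exprn_ge0.
have A_le' : `|a chi| ^+ 2 * n%:R ^+ m <= e ^+ (3 * m) * (selfpow chi)%:R by rewrite real_normK ?num_real.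
have A_le2 : `|a chi| <= (e ^+ 2 * z ^+ 2) ^+ m.
  rewrite -(@ler_pXn2r _ 2) ?nnegrE ?exprn_ge0 ?mulr_ge0 ?exprn_ge0 //.
  rewrite -(ler_pM2r (natrX_gt0 m)); apply: le_trans A_le' _.
  apply: (@le_trans _ _ (e ^+ (4 * m) * m%:R ^+ m)).
    by apply: ler_pM => //; rewrite ler_weXn2l ?e_ge1 // leq_mul2r orbT.
  have -> : (e ^+ 2 * z ^+ 2) ^+ m ^+ 2 = e ^+ (4 * m) * (z ^+ 4) ^+ m.
    rewrite -(exprM _ m 2) (mulnC m 2) (exprM _ 2 m) (exprM e 4 m) -[RHS]exprMn.
    by congr (_ ^+ _); ring.
  by rewrite z4 expr_div_n -mulrA divfK // gt_eqF // natrX_gt0.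
apply: (@le_trans _ _ ((2 * e ^+ 6 * z) ^+ m * (2^-1 * z) ^+ m * \prod_v (occ chi v)%:R ^+ occ chi v)); last first.
  by rewrite ler_wpM2r // ler_wpM2l.
have -> : (2 * e ^+ 6 * z) ^+ m * (2^-1 * z) ^+ m = (e ^+ 2 * z ^+ 2) ^+ m * e ^+ m * e ^+ (3 * m).
  by rewrite [(3 * m)%N]mulnC exprM exprAC -!exprMn; congr (_ ^+ _); field.
have nE : n%:R ^+ n = n%:R ^+ m * n%:R ^+ (n - m) :> R by rewrite -exprD subnKC.
rewrite PE nE.
apply: cube_bound A_le2 A_le' (pow_le_shift R mn); by rewrite ?em_ge0 ?exprn_ge0.
Qed.


(** Only the product of supremum and mass is assumed small, since each of the two depends on n. *)
Lemma sum_cube_le_mass (m : nat) (P : pred freq) (c : R) :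
  0 <= c -> (forall chi, #|supp chi| == m -> P chi -> `|a chi| * mass a m <= c) ->
  \sum_(chi | (#|supp chi| == m) && P chi) `|a chi| ^+ 3 <= c.
Proof.
move=> c_ge0 h; have sq_le : \sum_(chi | (#|supp chi| == m) && P chi) a chi ^+ 2 <= mass a m.
  rewrite /mass [X in _ <= X](bigID P) /= lerDl; apply: sumr_ge0 => chi _; exact: sqr_ge0.
have [W0|W_neq0] := eqVneq (mass a m) 0.
  rewrite big1 // => chi /andP[cm _]; rewrite norm_cube.
  have /psumr_eq0P h0 := W0; rewrite h0 ?mulr0 // => psi _; exact: sqr_ge0.
have W_gt0 : 0 < mass a m by rewrite lt0r W_neq0 mass_ge0.
rewrite -(ler_pM2r W_gt0) mulr_suml; apply: le_trans (ler_wpM2l c_ge0 sq_le).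
rewrite mulr_sumr; apply: ler_sum => chi /andP[cm Pchi].
by rewrite norm_cube mulrAC ler_wpM2r ?sqr_ge0 // h.
Qed.

Lemma expr_regroup (x y : R) (m : nat) :
  (x ^+ (4 * m) * (y ^+ m) ^+ 2) ^+ 4 = (y ^+ 8 * x ^+ 16) ^+ m.
Proof.
rewrite [LHS]exprMn [RHS]exprMn mulrC -(exprM y m 2) -(exprM y (m * 2) 4) -(exprM x _ 4).
rewrite -(exprM y 8) -(exprM x 16); congr (_ * _).
  by have -> : (m * 2 * 4 = 8 * m)%N by lia.
by have -> : (4 * m * 4 = 16 * m)%N by lia.
Qed.

(** With more than m/4 colours, [selfpow_ncolours] gives selfpow^4 <= m^(3m + 3). In |a| times mass
    the powers of n cancel, and the eighth power of this product is at most (3^8 e^19 / m)^m, where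
    e^3 out of e^19 covers the stray m^3. The lower bound on m turns this into 2^(-8m). *)
Lemma sum_many_colours (m : nat) : (0 < m)%N ->
  (2 ^+ 8 * 3 ^+ 8 * e ^+ 19 <= m%:R) ->
  \sum_(chi | (#|supp chi| == m) && (m < 4 * ncolours chi)%N) `|a chi| ^+ 3 <= 2^-1 ^+ m.
Proof.
move=> m_gt0 m_large; apply: sum_cube_le_mass; first by rewrite exprn_ge0 ?invr_ge0.
move=> chi /eqP cm t_gt.
have mr_gt0 : 0 < m%:R :> R by rewrite ltr0n.
have q4_le : (selfpow chi ^ 4 <= m ^ (3 * m + 3))%N.
  have := @selfpow_ncolours _ _ chi; rewrite cm => /(_ m_gt0) h.
  have := leq_exp2r (selfpow chi * m ^ ncolours chi) (m ^ m.+1) (isT : 0 < 4)%N; rewrite h.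
  rewrite expnMn -!expnM => h4.
  rewrite -(leq_pmul2r (m := m ^ (m.+1))) ?expn_gt0 ?m_gt0 // -expnD.
  apply: leq_trans (_ : (selfpow chi ^ 4 * m ^ (ncolours chi * 4) <= _)%N).
    rewrite leq_mul2l; apply/orP; right; apply: leq_pexp2l => //.
    by rewrite mulnC.
  by apply: leq_trans h4 _; apply: leq_pexp2l => //; lia.
have A_le := sup_supp a_spec chi; rewrite cm in A_le.
have W_le := mass_bound a_spec m.
have fm := expn_fact_le R m.
have W_ge0 := mass_ge0 a m.
have f_gt0 : 0 < m`!%:R :> R by rewrite ltr0n fact_gt0.
have em_ge0 k : 0 <= e ^+ k by rewrite exprn_ge0 ?expR_ge0.
have N_gt0 := natrX_gt0 m.
have W2_le : mass a m ^+ 2 * m`!%:R <= (3 ^+ m) ^+ 2 * n%:R ^+ m.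
  have : mass a m ^+ 2 <= (3 ^+ m * Num.sqrt (n%:R ^+ m / m`!%:R)) ^+ 2.
    by rewrite lerXn2r ?nnegrE ?mulr_ge0 ?exprn_ge0 ?sqrtr_ge0.
  rewrite exprMn sqr_sqrtr ?divr_ge0 ?exprn_ge0 // => /(ler_wpM2r (ltW f_gt0)).
  by rewrite -!mulrA mulVf ?mulr1 // gt_eqF.
have AW2 : (`|a chi| * mass a m) ^+ 2 * m%:R ^+ m <= e ^+ (4 * m) * (3 ^+ m) ^+ 2 * (selfpow chi)%:R.
  have h1 : a chi ^+ 2 * n%:R ^+ m * (mass a m ^+ 2 * m`!%:R) <=
      e ^+ (3 * m) * (selfpow chi)%:R * ((3 ^+ m) ^+ 2 * n%:R ^+ m).
    by apply: ler_pM => //; apply: mulr_ge0; rewrite ?sqr_ge0 ?exprn_ge0 ?ler0n.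
  have h2 : a chi ^+ 2 * mass a m ^+ 2 * m`!%:R <= e ^+ (3 * m) * (selfpow chi)%:R * (3 ^+ m) ^+ 2.
    rewrite -(ler_pM2r N_gt0); apply: le_trans (le_trans _ h1) _;
      by rewrite le_eqVlt; apply/orP; left; apply/eqP; ring.
  rewrite exprMn real_normK ?num_real //.
  have h3 : 0 <= a chi ^+ 2 * mass a m ^+ 2 by rewrite mulr_ge0 ?sqr_ge0.
  apply: le_trans (ler_wpM2l h3 fm) _; rewrite mulrCA.
  apply: le_trans (ler_wpM2l (em_ge0 m) h2) _.
  by rewrite le_eqVlt; apply/orP; left; apply/eqP; rewrite (exprM _ 4) (exprM _ 3) -!exprM !(mulnC _ m) !exprM; ring.
have q4_le' : (selfpow chi)%:R ^+ 4 <= m%:R ^+ (3 * m + 3) :> R by rewrite -!natrX ler_nat.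
have m_le_e : m%:R <= e ^+ m.
  by rewrite -expR_nat; apply: le_trans (expR_ge1Dx _); rewrite lerDr.
have main : (`|a chi| * mass a m) ^+ 8 * m%:R ^+ m <= (3 ^+ 8 * e ^+ 19) ^+ m.
  have AW_ge0 : 0 <= `|a chi| * mass a m by rewrite mulr_ge0.
  have h4 : ((`|a chi| * mass a m) ^+ 2 * m%:R ^+ m) ^+ 4 <=
      (e ^+ (4 * m) * (3 ^+ m) ^+ 2 * (selfpow chi)%:R) ^+ 4.
    by apply: lerXn2r => //; rewrite nnegrE !mulr_ge0 ?exprn_ge0 ?mulr_ge0 ?expR_ge0.
  have m3 : m%:R ^+ 3 <= (e ^+ m) ^+ 3 :> R by rewrite lerXn2r ?nnegrE ?ler0n.
  have Mm_gt0 : 0 < m%:R ^+ m :> R by rewrite exprn_gt0.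
  move: (`|a chi| * mass a m) AW_ge0 h4 => X X_ge0 h4.
  rewrite -(ler_pM2r (exprn_gt0 3 Mm_gt0)).
  apply: le_trans (le_trans _ h4) _.
    by rewrite le_eqVlt; apply/orP; left; apply/eqP; ring.
  rewrite exprMn; apply: (@le_trans _ _ ((e ^+ (4 * m) * (3 ^+ m) ^+ 2) ^+ 4 * m%:R ^+ (3 * m + 3))).
    by rewrite ler_wpM2l // exprn_ge0 // mulr_ge0 ?exprn_ge0 ?expR_ge0.
  have -> : (e ^+ (4 * m) * (3 ^+ m) ^+ 2) ^+ 4 = (3 ^+ 8 * e ^+ 16) ^+ m.
    exact: expr_regroup.
  have -> : m%:R ^+ (3 * m + 3) = (m%:R ^+ m) ^+ 3 * m%:R ^+ 3 :> R by rewrite exprD -exprM mulnC.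
  rewrite mulrCA mulrC; apply: ler_wpM2r; first by rewrite exprn_ge0 // ltW.
  apply: le_trans (ler_wpM2l _ m3) _; first by rewrite exprn_ge0 // mulr_ge0 // exprn_ge0 ?expR_ge0.
  by rewrite -exprM [(m * 3)%N]mulnC exprM -exprMn -mulrA -exprD.
have X_ge0 : 0 <= `|a chi| * mass a m by rewrite mulr_ge0.
have Mm_gt0 : 0 < m%:R ^+ m :> R by rewrite exprn_gt0.
rewrite -(@ler_pXn2r _ 8) ?nnegrE ?exprn_ge0 ?invr_ge0 //.
rewrite -(ler_pM2r Mm_gt0); apply: (le_trans main).
rewrite exprAC -exprMn; apply: lerXn2r; rewrite ?nnegrE ?mulr_ge0 ?exprn_ge0 ?invr_ge0 ?expR_ge0 //.
by rewrite exprVn ler_pdivlMl ?exprn_gt0 // mulrA.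
Qed.

End Sparse.

(** * Minor arcs without a majority value *)

Section Spread.
Variables (R : realType) (n : nat) (V : finZmodType) (a : {ffun 'I_n -> V} -> R).
Hypothesis a_spec : bij_spectrum a.
Hypothesis n_gt0 : (0 < n)%N.
Local Notation freq := {ffun 'I_n -> V}.
Local Notation e := (expR 1 : R).
Implicit Types (chi : freq).

Definition spread (c : R) chi := [forall v, (occ chi v)%:R <= (1 - c) * n%:R].

Lemma geometric_sum (d : R) k : 0 < d <= 1 -> d * \sum_(j < k) (1 - d) ^+ j.+1 <= 1.
Proof.
move=> /andP[d_gt0 d_le1].
have -> : d * \sum_(j < k) (1 - d) ^+ j.+1 = (1 - d) * (1 - (1 - d) ^+ k).
  elim: k => [|k IHk]; first by rewrite big_ord0 expr0 subrr !mulr0.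
  by rewrite big_ord_recr /= mulrDr IHk !exprS; move: ((1 - d) ^+ k) => u; ring.
have u_ge0 : 0 <= (1 - d) ^+ k by rewrite exprn_ge0 // subr_ge0.
by rewrite mulr_ile1 ?subr_ge0 ?exprn_ile1 ?subr_ge0 ?gerBl // ltW.
Qed.

Lemma all_coloursX (x : R) chi : \prod_v (if (0 < occ chi v)%N then x else 1) = x ^+ all_colours chi.
Proof.
rewrite -big_mkcond /= prodr_const; congr (_ ^+ _).
by apply: eq_card => v; rewrite !inE.
Qed.

(** As no colour exceeds (1 - c) n, the product of the nu^nu is at most exp(-c n) n^n, and |a| gains
    exp(-c n / 2). One factor |a| is spent on this gain; the other two compensate the number of
    rearrangements. With at most n/L colours, the loss d^(-5) per colour stays below exp(c n /
    8). *)
Lemma spread_few (c d : R) (L : nat) : 0 < c < 1 -> d = c / 24 -> d ^- 5 <= expR (c / 8 * L%:R) ->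
  \sum_(chi | spread c chi && (all_colours chi * L <= n)%N) `|a chi| ^+ 3 <= 1.
Proof.
move=> /andP[c_gt0 c_lt1] dE L_large.
(* The exponents divided by n, at d = c/24: 2d for (1 - d)^(-n), 3d from the cube of [sup_all], -c/2
   from the spread, c/8 for the colours, d for the sum of the weights. *)
have lin : 2 * (c / 24) + (3 * (c / 24) - c / 2 + c / 8) + c / 24 <= 0 by lra.
have d_gt0 : 0 < d by lra.
have d_ge0 := ltW d_gt0.
have d_le : d <= 2^-1 by lra.
have d1_gt0 : 0 < 1 - d by lra.
have d1_ge0 := ltW d1_gt0.
(* The ratio 1 - d makes the total weight of a colour at most 1 + d^2 / d = 1 + d. A colour that
   occurs costs d^(-2), which joins d^(-3) from the cube. *)
pose h (v : V) (k : nat) : R := (1 - d) ^+ k * (if (0 < k)%N then d ^+ 2 else 1).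
have h_ge0 v k : 0 <= h v k.
  by rewrite mulr_ge0 ?exprn_ge0 //; case: ifP => // _; rewrite exprn_ge0.
pose B : R := (1 - d) ^- n * expR ((3 * d - c / 2 + c / 8) * n%:R).
have B_ge0 : 0 <= B by rewrite mulr_ge0 ?expR_ge0 // invr_ge0 exprn_ge0.
apply: le_trans (sum_le_type_weights n_gt0 B_ge0 h_ge0 _) _; last first.
  have h_le : \prod_(v : V) \sum_(k < n.+1) h v k <= expR (d * n%:R).
    apply: (@le_trans _ _ (\prod_(v : V) (1 + d))).
      apply: ler_prod => v _; apply/andP; split; first by apply: sumr_ge0.
      rewrite /h big_ord_recl /= expr0 !mulr1 lerD2l.
      rewrite -[X in _ <= X]mulr1; apply: le_trans (ler_wpM2l d_ge0 (@geometric_sum d n _)); last by lra.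
      by rewrite mulrA mulr_sumr; apply: ler_sum => k _; rewrite mulrC expr2.
    rewrite prodr_const (bs_card a_spec) mulrC; apply: expD1_le.
    by lra.
  apply: le_trans (ler_wpM2l B_ge0 h_le) _.
  have inv_le : (1 - d) ^- n <= expR (2 * d * n%:R).
    rewrite mulrC expRM_natl -exprVn lerXn2r ?nnegrE ?invr_ge0 ?expR_ge0 //.
    apply: le_trans (expR_ge1Dx _); rewrite -[_^-1]mul1r ler_pdivrMr //.
    have -> : (1 + 2 * d) * (1 - d) = 1 + 2 * (d * (2^-1 - d)) by field.
    by rewrite lerDl !mulr_ge0 // subr_ge0.
  apply: (@le_trans _ _ (expR (2 * d * n%:R) * expR ((3 * d - c / 2 + c / 8) * n%:R) * expR (d * n%:R))).
    by rewrite ler_wpM2r ?expR_ge0 // ler_wpM2r ?expR_ge0.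
  rewrite -!expRD expR_le1 -!mulrDl dE pmulr_lle0 ?natr_pos //.
move=> chi /andP[/forallP chi_spread t_le].
have := sup_all a_spec chi d_gt0.
set D := d ^- _ * _; have D_ge0 : 0 <= D by rewrite mulr_ge0 ?expR_ge0 // invr_ge0 exprn_ge0.
rewrite natr_prod (eq_bigr (fun v => (occ chi v)%:R ^+ occ chi v)) => [|v _]; last by rewrite natrX.
set P := \prod_v _ => A2_le.
have P_ge0 : 0 <= P by apply: prodr_ge0 => v _; rewrite exprn_ge0.
have N_gt0 := natrX_gt0 R n_gt0 n.
have P_le : P <= expR (- c * n%:R) * n%:R ^+ n.
  apply: (@le_trans _ _ (\prod_v ((1 - c) * n%:R) ^+ occ chi v)).
    apply: ler_prod => v _; rewrite exprn_ge0 //= lerXn2r ?nnegrE //.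
    by rewrite mulr_ge0 // subr_ge0 ltW.
  rewrite -expr_sum sum_occ exprMn ler_wpM2r ?(ltW N_gt0) // mulrC.
  by apply: expD1_le; lra.
have A_le : `|a chi| <= D * expR (- c / 2 * n%:R).
  rewrite -(@ler_pXn2r _ 2) ?nnegrE ?(mulr_ge0 D_ge0) ?expR_ge0 // real_normK ?num_real //.
  rewrite -(ler_pM2r N_gt0); apply: (le_trans A2_le).
  rewrite [X in _ <= X](_ : _ = D ^+ 2 * (expR (- c / 2 * n%:R) ^+ 2 * n%:R ^+ n)); last by ring.
  apply: ler_wpM2l; first exact: sqr_ge0.
  apply: (le_trans P_le).
  by rewrite ler_wpM2r ?(ltW N_gt0) // -expRM_natl ler_expR; lra.
apply: (@le_trans _ _ (D ^+ 3 * expR (- c / 2 * n%:R) * P)).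
  rewrite norm_cube [X in X <= _](_ : _ = `|a chi| * (a chi ^+ 2 * n%:R ^+ n)); last by rewrite -mulrA.
  rewrite [X in _ <= X](_ : _ = (D * expR (- c / 2 * n%:R)) * (D ^+ 2 * P)); last by ring.
  by apply: ler_pM => //; rewrite mulr_ge0 ?sqr_ge0 ?(ltW N_gt0).
rewrite ler_wpM2r // /h big_split /= -expr_sum sum_occ all_coloursX /B.
have d1n_neq0 : (1 - d) ^+ n != 0 by rewrite expf_neq0 // gt_eqF.
rewrite [X in _ <= X](_ : _ = expR ((3 * d - c / 2 + c / 8) * n%:R) * (d ^+ 2) ^+ all_colours chi); last by field.
have dt : (d ^- all_colours chi) ^+ 5 <= expR (c / 8 * n%:R).
  rewrite -[d ^- all_colours chi]exprVn exprAC exprVn.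
  apply: (@le_trans _ _ (expR (c / 8 * L%:R) ^+ all_colours chi)).
    by rewrite lerXn2r ?nnegrE ?invr_ge0 ?exprn_ge0 ?expR_ge0.
  rewrite -expRM_natl ler_expR mulrCA ler_wpM2l //; first by lra.
  by rewrite -natrM ler_nat.
have -> : (d ^+ 2) ^+ all_colours chi = (d ^- all_colours chi) ^+ 3 / (d ^- all_colours chi) ^+ 5.
  rewrite exprAC; move: (d ^+ all_colours chi) (lt0r_neq0 (exprn_gt0 (all_colours chi) d_gt0)) => u u0.
  by field.
have x3_ge0 : 0 <= (d ^- all_colours chi) ^+ 3 by rewrite exprn_ge0 // invr_ge0 exprn_ge0.
have dt_gt0 : 0 < (d ^- all_colours chi) ^+ 5 by rewrite exprn_gt0 // invr_gt0 exprn_gt0.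
rewrite /D; move: (d ^- all_colours chi) dt dt_gt0 x3_ge0 => x dt dt_gt0 x3_ge0.
rewrite [X in X <= _](_ : _ = x ^+ 3 * (expR (d * n%:R) ^+ 3 * expR (- c / 2 * n%:R))); last by ring.
rewrite [X in _ <= X](_ : _ = x ^+ 3 * (expR ((3 * d - c / 2 + c / 8) * n%:R) / x ^+ 5)); last by ring.
apply: ler_wpM2l => //.
rewrite ler_pdivlMr // -expRM_natl -expRD.
apply: le_trans (ler_wpM2l (expR_ge0 _) dt) _.
by rewrite -expRD ler_expR; lra.
Qed.


(** With t > n/L colours, [prod_selfpow_le] saves a factor n^t >= K^n in the square of a, whence |a|
    <= e^(-n). The total L^2 mass n^n / n! is at most e^n. *)
Lemma spread_many (d : R) (L : nat) : 0 < d < 1 ->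
  (d ^- 2 * expR (2 * d) * e ^+ 3) ^+ L <= n%:R ->
  \sum_(chi | (n < all_colours chi * L)%N) `|a chi| ^+ 3 <= 1.
Proof.
move=> /andP[d_gt0 d_lt1] n_large.
have d_ge0 := ltW d_gt0.
(* e^3 covers the factor n <= e^n and the square of the desired e^n; the rest is [sup_all] with
   d^(-t) weakened to d^(-n). *)
pose K : R := d ^- 2 * expR (2 * d) * e ^+ 3.
have di_ge1 : 1 <= d^-1 by rewrite invf_ge1 // ltW.
have K_ge1 : 1 <= K.
  rewrite /K -exprVn; apply: mulr_ege1; last by rewrite exprn_ege1 // e_ge1.
  apply: mulr_ege1; rewrite ?exprn_ege1 //.
  by apply: le_trans (expR_ge1Dx _); rewrite lerDl mulr_ge0.
have N_gt0 := natrX_gt0 R n_gt0 n.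
have en_gt0 : 0 < e ^+ n by rewrite exprn_gt0 ?expR_gt0.
have parseval : \sum_chi a chi ^+ 2 <= e ^+ n.
  have := bs_mass a_spec setT; rewrite cardsT card_ord subnn fact0 mulr1.
  rewrite (eq_bigl predT) => [->|chi]; last by rewrite subsetT.
  by rewrite ler_pdivrMr ?ltr0n ?fact_gt0 // expn_fact_le.
have n_le_e : n%:R <= e ^+ n.
  by rewrite -expR_nat; apply: le_trans (expR_ge1Dx _); rewrite lerDr.
have main chi : (n < all_colours chi * L)%N -> `|a chi| <= e ^- n.
  move=> t_gt; set t := all_colours chi in t_gt.
  have t_le : (t <= n)%N.
    rewrite -[X in (_ <= X)%N](sum_occ chi) /t /all_colours -sum1dep_card big_mkcond.
    by apply: leq_sum => v _; case: (occ chi v).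
  have := sup_all a_spec chi d_gt0; rewrite -/t.
  have P_le : (\prod_v occ chi v ^ occ chi v * n ^ t <= n ^ n.+1)%N.
    have := @prod_selfpow_le _ predT (occ chi); rewrite /= sum_occ => /(_ n_gt0).
    by rewrite (eq_card (B := [set v | (0 < occ chi v)%N])) // => v; rewrite !inE.
  have P_le' : (\prod_v occ chi v ^ occ chi v)%N%:R * n%:R ^+ t <= n%:R ^+ n * n%:R :> R.
    by rewrite -exprSr -!natrX -natrM ler_nat.
  move: P_le'; move: (\prod_v _)%N%:R (ler0n R (\prod_v occ chi v ^ occ chi v)%N) => P P_ge0 P_le' A_le.
  have D_le : (d ^- t * expR (d * n%:R)) ^+ 2 <= (d ^- 2 * expR (2 * d)) ^+ n.
    rewrite -!exprVn exprMn [X in _ <= X]exprMn ler_pM ?exprn_ge0 ?invr_ge0 ?expR_ge0 //.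
      by rewrite exprAC ler_weXn2l // exprn_ege1.
    by rewrite -!expRM_natl ler_expR; lra.
  have Kn_le : K ^+ n <= n%:R ^+ t.
    apply: (@le_trans _ _ (K ^+ (L * t))); first by rewrite ler_weXn2l // ltnW // mulnC.
    by rewrite exprM lerXn2r ?nnegrE ?exprn_ge0 // (le_trans ler01).
  have KE : K ^+ n = (d ^- 2 * expR (2 * d)) ^+ n * (e ^+ n) ^+ 3.
    by rewrite /K exprMn exprAC.
  rewrite -(@ler_pXn2r _ 2) ?nnegrE ?invr_ge0 ?(ltW en_gt0) // real_normK ?num_real //.
  have nt_gt0 := natrX_gt0 R n_gt0 t.
  rewrite KE in Kn_le; have en_ge0 := ltW en_gt0.
  have D2_gt0 : 0 < (d ^- 2 * expR (2 * d)) ^+ n by rewrite exprn_gt0 // mulr_gt0 ?expR_gt0 // invr_gt0 exprn_gt0.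
  move: D2_gt0 D_le A_le Kn_le; move: ((d ^- t * _) ^+ 2) ((d ^- 2 * _) ^+ n) => D1 D2 D2_gt0 D_le A_le Kn_le.
  have h1 : a chi ^+ 2 * n%:R ^+ t <= D2 * n%:R.
    rewrite -(ler_pM2r N_gt0) mulrAC; apply: le_trans (ler_wpM2r (ltW nt_gt0) A_le) _.
    rewrite -mulrA -[X in _ <= X]mulrA [n%:R * _]mulrC.
    apply: le_trans (ler_wpM2l (ltW D2_gt0) P_le').
    by rewrite ler_wpM2r // mulr_ge0 // ltW.
  have h2 : a chi ^+ 2 * (D2 * (e ^+ n) ^+ 3) <= D2 * e ^+ n.
    apply: le_trans (ler_wpM2l (sqr_ge0 _) Kn_le) (le_trans h1 _).
    by rewrite ler_wpM2l // ltW.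
  have -> : e ^- n ^+ 2 = 1 / (e ^+ n) ^+ 2 by rewrite exprVn div1r.
  rewrite ler_pdivlMr ?(exprn_gt0 2 en_gt0) // -(ler_pM2r (mulr_gt0 D2_gt0 en_gt0)) mul1r.
  by apply: le_trans h2; rewrite le_eqVlt; apply/orP; left; apply/eqP; ring.
apply: (@le_trans _ _ (\sum_(chi | (n < all_colours chi * L)%N) e ^- n * a chi ^+ 2)).
  by apply: ler_sum => chi /main h; rewrite norm_cube ler_wpM2r ?sqr_ge0.
rewrite -mulr_sumr ler_pdivrMl // mulr1; apply: le_trans parseval.
by rewrite [X in X <= _]big_mkcond; apply: ler_sum => chi _; case: ifP => // _; apply: sqr_ge0.
Qed.

End Spread.

(** * Major arcs *)

Section Move.
Variables (n : nat) (V : zmodType).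
Implicit Types (chi : {ffun 'I_n -> V}) (p q : 'I_n).

Lemma move_id chi p : move chi p p = chi.
Proof. by apply/ffunP => i; rewrite ffunE; case: eqP => [->|_]; rewrite ?add0r ?addr0. Qed.

Lemma move_tperm chi p q : chi q = 0 -> move chi p q = [ffun i => chi (tperm p q i)].
Proof.
move=> chiq; apply/ffunP => i; rewrite !ffunE.
have [->|ip] := eqVneq i p.
  rewrite tpermL chiq mulr0n add0r.
  by case: (eqVneq p q) => [->|_]; rewrite ?chiq ?mul0rn ?mulr0n.
have [->|iq] := eqVneq i q; first by rewrite tpermR chiq add0r.
by rewrite tpermD 1?eq_sym // addr0.
Qed.

Lemma supp_move chi p q : q != p -> q \in supp chi ->
  supp (move chi p q) = if chi q + chi p == 0 then supp chi :\ p :\ q else supp chi :\ p.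
Proof.
move=> qp; rewrite in_supp => q_supp; apply/setP => i; rewrite in_supp ffunE.
have [->|iq] := eqVneq i q.
  by rewrite qp; case: ifP => s0; rewrite ?inE ?eqxx ?qp ?q_supp ?s0 // (negbT s0).
rewrite addr0; have [->|ip] := eqVneq i p; first by rewrite mulr0n eqxx; case: ifP; rewrite !inE eqxx ?andbF.
by case: ifP; rewrite !inE ?iq ip.
Qed.

Lemma card_supp_move chi p q : p \in supp chi -> q != p -> q \in supp chi ->
  #|supp (move chi p q)| = if chi q + chi p == 0 then (#|supp chi| - 2)%N else #|supp chi|.-1.
Proof.
move=> p_supp qp q_supp; rewrite supp_move //.
have := cardsD1 p (supp chi); have := cardsD1 q (supp chi :\ p).
rewrite in_setD1 qp q_supp p_supp /= => h1 h2.
by case: ifP => _; lia.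
Qed.
End Move.

Section Recursion.
Variables (R : realType) (n : nat) (V : finZmodType) (a : {ffun 'I_n -> V} -> R).
Hypothesis a_spec : bij_spectrum a.
Local Notation freq := {ffun 'I_n -> V}.
Implicit Types (chi : freq).

(** In [bs_move] the n - m trivial positions q give rearrangements of chi and q = p gives chi
    itself; the genuine merges remain. *)
Lemma spec_merge chi p : p \in supp chi ->
  (n%:R - #|supp chi|%:R + 1) * a chi = - \sum_(q | (q != p) && (q \in supp chi)) a (move chi p q).
Proof.
move=> p_supp; have chip : chi p != 0 by rewrite -in_supp.
have inside : \sum_(q | q \in supp chi) a (move chi p q) =
    a chi + \sum_(q | (q != p) && (q \in supp chi)) a (move chi p q).
  by rewrite (bigD1 p) //= move_id; congr (_ + _); apply: eq_bigl => q; rewrite andbC.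
have outside : \sum_(q | q \notin supp chi) a (move chi p q) = (n%:R - #|supp chi|%:R) * a chi.
  rewrite (eq_bigr (fun=> a chi)) => [|q]; last first.
    by rewrite in_supp negbK => /eqP chiq; rewrite move_tperm // bs_perm.
  have -> : n%:R - #|supp chi|%:R = (occ chi 0)%:R :> R by rewrite occ0E natrB ?supp_le.
  rewrite sumr_const mulr_natl; congr (_ *+ _); apply: eq_card => q.
  by rewrite [in RHS]inE unfold_in /= in_supp negbK.
have := bs_move a_spec chip; rewrite (bigID (fun q => q \in supp chi)) /= inside outside.
by move=> h; apply/eqP; rewrite -addr_eq0 -[X in _ == X]h; apply/eqP; ring.
Qed.

End Recursion.

Lemma supp0P (n : nat) (V : zmodType) (chi : {ffun 'I_n -> V}) : #|supp chi| = 0%N -> chi = 0.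
Proof.
move=> /cards0_eq s0; apply/ffunP => i; rewrite ffunE; apply/eqP.
by rewrite -[_ == 0]negbK -in_supp s0 inE.
Qed.

(* Each merge of two coordinates costs a factor 1/n and removes at most two of them. *)
Lemma sup_fixed (R : realType) (m : nat) : exists2 K : R, 0 <= K &
  forall n (V : finZmodType) (a : {ffun 'I_n -> V} -> R), bij_spectrum a ->
  (0 < n)%N -> (2 * m <= n)%N -> forall chi : {ffun 'I_n -> V}, #|supp chi| = m ->
  `|a chi| * n%:R ^+ uphalf m <= K.
Proof.
elim/ltn_ind: m => -[|m] IHm.
  exists 1 => // n V a a_spec _ _ chi /supp0P ->.
  by rewrite (bs_zero a_spec) normr1 expr0 mulr1.
have [K1 K1_ge0 hK1] := IHm m (ltnSn m).
(* An opposite merge leaves m - 1 of the m + 1 nontrivial coordinates. For m = 0 no merge exists and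
   the constant 0 is a dummy. *)
have [K2 K2_ge0 hK2] : exists2 K : R, 0 <= K & forall n (V : finZmodType) (a : {ffun 'I_n -> V} -> R),
    bij_spectrum a -> (0 < n)%N -> (2 * m.+1 <= n)%N -> forall chi : {ffun 'I_n -> V},
    (#|supp chi| = m.-1)%N -> (0 < m)%N -> `|a chi| * n%:R ^+ uphalf m.-1 <= K.
  case: m IHm {K1 K1_ge0 hK1} => [|m] IHm; first by exists 0.
  have [K K_ge0 hK] := IHm m (ltnW (ltnSn _)).
  by exists K => // n V a a_spec n0 nm chi cm _; apply: (hK _ _ _ a_spec) => //; lia.
exists (2 * m.+1%:R * (K1 + K2)); first by rewrite !mulr_ge0 // addr_ge0.
move=> n V a a_spec n_gt0 nm chi cm.
have [p p_supp] : exists p, p \in supp chi by apply/set0Pn; rewrite -card_gt0 cm.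
have n_pos : 0 < n%:R :> R by rewrite ltr0n.
have n_ge1 : 1 <= n%:R :> R by rewrite ler1n.
have := spec_merge a_spec p_supp; rewrite cm => rec.
have term q : (q != p) && (q \in supp chi) -> `|a (move chi p q)| * n%:R ^+ m./2 <= K1 + K2.
  move=> /andP[qp q_supp]; have := card_supp_move p_supp qp q_supp; rewrite cm /=.
  have m_gt0 : (0 < m)%N.
    rewrite -ltnS -cm (cardsD1 p) p_supp add1n ltnS card_gt0.
    by apply/set0Pn; exists q; rewrite in_setD1 qp.
  case: ifP => _ cm'.
    have uE : uphalf m.-1 = m./2 by case: (m) m_gt0 => // k _; rewrite /= uphalf_half; lia.
    have := hK2 _ _ _ a_spec n_gt0 nm (move chi p q); rewrite cm' uE subSS subn1 => /(_ erefl m_gt0).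
    by move=> /le_trans; apply; rewrite lerDr.
  have := hK1 _ _ _ a_spec n_gt0 _ (move chi p q) cm'; move=> /(_ _)/le_trans h.
  apply: (@le_trans _ _ (`|a (move chi p q)| * n%:R ^+ uphalf m)).
    by rewrite ler_wpM2l // ler_weXn2l // uphalf_half leq_addl.
  by apply: h; [lia|rewrite lerDl].
have sum_le : `|\sum_(q | (q != p) && (q \in supp chi)) a (move chi p q)| * n%:R ^+ m./2 <= m.+1%:R * (K1 + K2).
  apply: le_trans (ler_wpM2r _ (ler_norm_sum _ _ _)) _; first by rewrite exprn_ge0.
  rewrite mulr_suml; apply: le_trans (ler_sum _ term) _.
  rewrite sumr_const -[X in X <= _]mulr_natl ler_wpM2r ?addr_ge0 // ler_nat -cm.
  by apply: subset_leq_card; apply/subsetP => q /andP[].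
have half : n%:R / 2 <= n%:R - m.+1%:R + 1 :> R.
  have : 2 * m.+1%:R <= n%:R :> R by rewrite -natrM ler_nat.
  by lra.
have D_gt0 : 0 < n%:R - m.+1%:R + 1 :> R by apply: lt_le_trans half; rewrite divr_gt0.
have := congr1 Num.norm rec; rewrite normrM normrN (gtr0_norm D_gt0) => rec'.
rewrite -rec' in sum_le; rewrite /= exprS mulrCA.
have X_ge0 : 0 <= `|a chi| * n%:R ^+ m./2 by rewrite mulr_ge0 // exprn_ge0.
rewrite -mulrA in sum_le; have h := le_trans (ler_wpM2r X_ge0 half) sum_le.
have -> : n%:R * (`|a chi| * n%:R ^+ m./2) = 2 * (n%:R / 2 * (`|a chi| * n%:R ^+ m./2)) by field.
by rewrite -!mulrA; apply: ler_wpM2l => //; rewrite mulrA in h *.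
Qed.

(** * Removing and restoring opposite pairs *)

Section OppositePairs.
Variables (R : realType) (n : nat) (V : finZmodType).
Implicit Types (chi psi : {ffun 'I_n -> V}) (p q : 'I_n) (v : V).

(** Inverse to an opposite merge: v and -v are put back at two trivial positions. *)
Definition insert_pair p q (x : {ffun 'I_n -> V} * V) : {ffun 'I_n -> V} :=
  [ffun i => if i == p then x.2 else if i == q then - x.2 else x.1 i].

Lemma card_supp_insert_pair p q psi v : q != p -> psi p = 0 -> psi q = 0 -> v != 0 ->
  #|supp (insert_pair p q (psi, v))| = #|supp psi|.+2.
Proof.
move=> qp psip psiq v0.
have -> : supp (insert_pair p q (psi, v)) = p |: (q |: supp psi).
  apply/setP => i; rewrite in_supp ffunE !inE /=.
  have [_|ip] := eqVneq i p; first by rewrite v0.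
  by have [_|iq] := eqVneq i q; first by rewrite oppr_eq0 v0.
by rewrite !cardsU1 !inE psip psiq eqxx eq_sym (negPf qp) !add1n.
Qed.

Lemma sum_insert_pair m p q (F : {ffun 'I_n -> V} -> V -> R) : q != p ->
  \sum_(chi | [&& #|supp chi| == m.+2, chi p != 0 & chi q + chi p == 0]) F (move chi p q) (chi p) =
  \sum_(psi | [&& #|supp psi| == m, psi p == 0 & psi q == 0]) \sum_(v | v != 0) F psi v.
Proof.
move=> qp; rewrite pair_big_dep /=.
have insK chi : chi q + chi p = 0 -> insert_pair p q (move chi p q, chi p) = chi.
  move=> s0; apply/ffunP => i; rewrite !ffunE /=.
  have [->//|ip] := eqVneq i p; have [->|iq] := eqVneq i q; last by rewrite mulr0n addr0.
  by apply/eqP; rewrite eq_sym -addr_eq0 s0.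
rewrite (reindex_onto (insert_pair p q) (fun chi => (move chi p q, chi p))) /=; last first.
  by move=> chi /and3P[_ _ /eqP]; apply: insK.
have moveK psi v : psi p = 0 -> psi q = 0 -> move (insert_pair p q (psi, v)) p q = psi.
  move=> psip psiq; apply/ffunP => i; rewrite !ffunE /= eqxx.
  have [->|ip] := eqVneq i p; first by rewrite mulr0n add0r eq_sym (negPf qp) psip.
  by have [->|iq] := eqVneq i q; rewrite ?mulr0n ?addr0 // addNr psiq.
have insp psi v : insert_pair p q (psi, v) p = v by rewrite ffunE eqxx.
have insq psi v : insert_pair p q (psi, v) q = - v by rewrite ffunE (negPf qp) eqxx.
apply: eq_big => [[psi v]|[psi v]] /=.
  rewrite insp insq addNr eqxx andbT.
  apply/andP/andP => [[/andP[/eqP c v0] /eqP[E]]|[/and3P[/eqP c /eqP psip /eqP psiq] v0]].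
    have psip : psi p = 0.
      by rewrite -E ffunE eqxx mulr0n add0r eq_sym (negPf qp).
    have psiq : psi q = 0 by rewrite -E ffunE qp eqxx insp insq mulr1n addNr.
    by move: c; rewrite card_supp_insert_pair // => -[->]; rewrite psip psiq !eqxx v0.
  by rewrite card_supp_insert_pair // c eqxx v0 moveK.
case/andP => /andP[/eqP c]; rewrite insp insq => /andP[v0 _] /eqP[E].
by rewrite E.
Qed.

(** A tuple with a marked opposite pair amounts to a smaller tuple psi, an ordered pair of its
    trivial positions and a nontrivial v. As F sees only psi and v, the positions contribute a mere
    count. *)
Lemma sum_opposite_pairs m (F : {ffun 'I_n -> V} -> V -> R) :
  \sum_(chi | #|supp chi| == m.+2) \sum_(p | p \in supp chi)
    \sum_(q | (q != p) && (chi q + chi p == 0)) F (move chi p q) (chi p) =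
  (n%:R - m%:R) * (n%:R - m%:R - 1) * \sum_(psi | #|supp psi| == m) \sum_(v | v != 0) F psi v.
Proof.
under eq_bigr do rewrite big_mkcond /=.
rewrite exchange_big /=.
have step p : \sum_(chi | #|supp chi| == m.+2) (if p \in supp chi then
      \sum_(q | (q != p) && (chi q + chi p == 0)) F (move chi p q) (chi p) else 0) =
    \sum_(q | q != p) \sum_(psi | [&& #|supp psi| == m, psi p == 0 & psi q == 0]) \sum_(v | v != 0) F psi v.
  rewrite -big_mkcondr /=.
  rewrite (eq_bigr (fun chi => \sum_(q | q != p) if chi q + chi p == 0 then F (move chi p q) (chi p) else 0)); last first.
    by move=> chi _; rewrite -big_mkcondr.
  rewrite exchange_big /=; apply: eq_bigr => q qp.
  rewrite -sum_insert_pair // -big_mkcondr; apply: eq_bigl => chi.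
  by rewrite in_supp -andbA.
under eq_bigr do rewrite step.
have swap p q : \sum_(psi | [&& #|supp psi| == m, psi p == 0 & psi q == 0]) \sum_(v | v != 0) F psi v =
    \sum_(psi | #|supp psi| == m) ((psi p == 0)%:R * (psi q == 0)%:R * \sum_(v | v != 0) F psi v).
  rewrite big_mkcondr /=; apply: eq_bigr => psi _.
  by case: eqP => _; case: eqP => _ /=; rewrite ?mul0r ?mulr0 ?mul0r // !mul1r.
under eq_bigr do under eq_bigr do rewrite swap.
under eq_bigr do rewrite exchange_big /=.
rewrite exchange_big mulr_sumr /=; apply: eq_bigr => psi /eqP cpsi.
have cnt : \sum_(p : 'I_n) (psi p == 0)%:R = n%:R - m%:R :> R.
  rewrite -natrB -?cpsi ?supp_le // -(occ0E psi) /occ -sum1dep_card natr_sum big_mkcond /=.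
  by rewrite [RHS]big_mkcond; apply: eq_bigr => p _; case: ifP.
under eq_bigr do rewrite -mulr_suml -mulr_sumr.
rewrite -mulr_suml; congr (_ * _).
have -> : \sum_(p : 'I_n) (psi p == 0)%:R * \sum_(q | q != p) (psi q == 0)%:R =
    \sum_(p : 'I_n) (psi p == 0)%:R * (n%:R - m%:R - 1) :> R.
  apply: eq_bigr => p _; have [psip|] := eqVneq (psi p) 0; last by rewrite !mul0r.
  by congr (_ * _); rewrite -cnt [X in _ = X - 1](bigD1 p) //= psip eqxx addrAC subrr add0r.
by rewrite -mulr_suml cnt.
Qed.

End OppositePairs.

Lemma sqr_sum_le (R : realFieldType) (I : finType) (P : pred I) (x : I -> R) :
  (\sum_(i | P i) x i) ^+ 2 <= #|P|%:R * \sum_(i | P i) x i ^+ 2.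
Proof.
rewrite expr2 big_distrlr /=.
apply: (@le_trans _ _ (\sum_(i | P i) \sum_(j | P j) (x i ^+ 2 / 2 + x j ^+ 2 / 2))).
  apply: ler_sum => i _; apply: ler_sum => j _.
  by have := sqr_ge0 (x i - x j); rewrite sqrrB; lra.
rewrite (eq_bigr (fun i => #|P|%:R * (x i ^+ 2 / 2) + \sum_(j | P j) x j ^+ 2 / 2)) => [|i _]; last first.
  by rewrite big_split sumr_const /= mulr_natl.
rewrite big_split sumr_const /= -mulr_sumr -mulr_suml -[X in _ + X]mulr_natl.
by rewrite le_eqVlt; apply/orP; left; apply/eqP; field.
Qed.

Lemma norm_subX3 (R : realFieldType) (x y : R) :
  `|x ^+ 3 - y ^+ 3| <= 3 / 2 * `|x - y| * (x ^+ 2 + y ^+ 2).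
Proof.
have -> : x ^+ 3 - y ^+ 3 = (x - y) * (x ^+ 2 + x * y + y ^+ 2) by ring.
rewrite normrM [3 / 2 * _]mulrC -mulrA ler_wpM2l //.
have h1 := sqr_ge0 (x + y); have h2 := sqr_ge0 (x - y).
rewrite sqrrD in h1; rewrite sqrrB in h2.
have [x2 y2] := (sqr_ge0 x, sqr_ge0 y).
rewrite ler_norml; apply/andP; split; lra.
Qed.

(** * Cube sums: odd sizes, and the step from m to m + 2 for even m *)

Section EvenStep.
Variables (R : realType) (n : nat) (V : finZmodType) (a : {ffun 'I_n -> V} -> R).
Hypothesis a_spec : bij_spectrum a.
Hypothesis n_gt0 : (0 < n)%N.
Local Notation freq := {ffun 'I_n -> V}.
Implicit Types (chi psi : freq).
Local Notation N := (n%:R : R).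

Definition cube_sum m : R := \sum_(chi | #|supp chi| == m) a chi ^+ 3.

Lemma mass_even (k : nat) : mass a (2 * k)%N <= 9 ^+ k * N ^+ k.
Proof.
apply: le_trans (mass_bound a_spec _) _; rewrite exprM.
have -> : 3 ^+ 2 = 9 :> R by rewrite -natrX.
rewrite ler_wpM2l ?exprn_ge0 // -[X in _ <= X]ger0_norm ?exprn_ge0 // -sqrtr_sqr.
apply: ler_wsqrtr; rewrite -exprM [(k * 2)%N]mulnC ler_pdivrMr ?ltr0n ?fact_gt0 //.
by rewrite ler_peMr ?exprn_ge0 // ler1n fact_gt0.
Qed.

(** For odd size 2k + 1 the supremum is O(n^(-k-1)) while the mass is only O(n^(k + 1/2)). *)
Lemma cube_sum_odd (k : nat) (K : R) : 0 <= K ->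
  (forall chi, #|supp chi| = (2 * k)%N.+1 -> `|a chi| * N ^+ k.+1 <= K) ->
  `|cube_sum (2 * k)%N.+1| * Num.sqrt N <= K * 3 ^+ (2 * k)%N.+1.
Proof.
move=> K_ge0 hK; have N_gt0 : 0 < N by rewrite ltr0n.
have Nk_gt0 := natrX_gt0 R n_gt0 k.
have s_gt0 : 0 < Num.sqrt N by rewrite sqrtr_gt0.
have sN : Num.sqrt N * Num.sqrt N = N by rewrite -expr2 sqr_sqrtr // ltW.
have h : `|cube_sum (2 * k)%N.+1| * N ^+ k.+1 <= K * mass a (2 * k)%N.+1.
  apply: le_trans (ler_wpM2r _ (ler_norm_sum _ _ _)) _; first by rewrite exprn_ge0.
  rewrite mulr_suml mulr_sumr; apply: ler_sum => chi /eqP c.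
  by rewrite normrX norm_cube mulrAC ler_wpM2r ?sqr_ge0 // hK.
have h2 : mass a (2 * k)%N.+1 <= 3 ^+ (2 * k)%N.+1 * (N ^+ k * Num.sqrt N).
  apply: le_trans (mass_bound a_spec _) _; rewrite ler_wpM2l ?exprn_ge0 //.
  have Nk_ge0 := ltW Nk_gt0; rewrite -[N ^+ k]ger0_norm // -sqrtr_sqr -sqrtrM ?sqr_ge0 //.
  apply: ler_wsqrtr; rewrite -exprM [(k * 2)%N]mulnC -exprSr ler_pdivrMr ?ltr0n ?fact_gt0 //.
  by rewrite ler_peMr ?exprn_ge0 // ler1n fact_gt0.
have h3 := le_trans h (ler_wpM2l K_ge0 h2).
rewrite -(ler_pM2r (mulr_gt0 Nk_gt0 s_gt0)) -[X in _ <= X]mulrA; apply: le_trans h3.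
have -> : `|cube_sum (2 * k)%N.+1| * Num.sqrt N * (N ^+ k * Num.sqrt N) =
    `|cube_sum (2 * k)%N.+1| * (N ^+ k * (Num.sqrt N * Num.sqrt N)) by ring.
by rewrite sN -exprSr.
Qed.

Section Step.
Variables (k : nat) (K1 K2 : R).
Local Notation m := (2 * k)%N.
Hypotheses (n_large : (m.+2 <= n)%N).
Hypothesis hK1 : forall chi, #|supp chi| = m.+1 -> `|a chi| * N ^+ k.+1 <= K1.
Hypothesis hK2 : forall chi, #|supp chi| = m -> `|a chi| * N ^+ k <= K2.
Hypotheses (K1_ge0 : 0 <= K1) (K2_ge0 : 0 <= K2).

(** Merges at p are divided by whether the two characters cancel. Those in [opp_sum] reach size m
    with values O(n^(-k)); those in [rest_sum] have size m + 1 and are smaller by a factor n. *)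
Definition opp_sum chi (p : 'I_n) := \sum_(q | (q != p) && (chi q + chi p == 0)) a (move chi p q).
Definition rest_sum chi (p : 'I_n) :=
  \sum_(q | (q != p) && (q \in supp chi) && (chi q + chi p != 0)) a (move chi p q).
Local Notation D := (N - m%:R - 1).

Lemma opp_supp chi p q : p \in supp chi -> chi q + chi p == 0 -> q \in supp chi.
Proof.
by rewrite !in_supp => p0 s0; apply: contra p0 => /eqP q0; rewrite q0 add0r in s0.
Qed.

Lemma merge_split chi p : #|supp chi| = m.+2 -> p \in supp chi ->
  - (D * a chi) = opp_sum chi p + rest_sum chi p.
Proof.
move=> c p_supp; have := spec_merge a_spec p_supp; rewrite c => rec.
have -> : D = N - m.+2%:R + 1 by rewrite -[m.+2]addn2 natrD; ring.
rewrite rec opprK (bigID (fun q => chi q + chi p == 0)) /=; congr (_ + _).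
apply: eq_bigl => q; apply/idP/idP => [/andP[/andP[-> _] ->] //|/andP[-> h]].
by rewrite h (opp_supp p_supp h).
Qed.

Lemma rest_le chi p : #|supp chi| = m.+2 -> p \in supp chi ->
  `|rest_sum chi p| * N ^+ k.+1 <= m.+2%:R * K1.
Proof.
move=> c p_supp; apply: le_trans (ler_wpM2r _ (ler_norm_sum _ _ _)) _; first by rewrite exprn_ge0.
rewrite mulr_suml; apply: (@le_trans _ _ (\sum_(q | q \in supp chi) K1)).
  rewrite [X in X <= _]big_mkcond [X in _ <= X]big_mkcond /=; apply: ler_sum => q _.
  case: (boolP (q \in supp chi)) => q_supp; last by rewrite andbF.
  case: (boolP (q != p)) => //= qp; case: (boolP (chi q + chi p == 0)) => //= s0.
  by apply: hK1; rewrite card_supp_move // (negPf s0) c.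
by rewrite sumr_const c mulr_natl.
Qed.

Lemma card_opp_le chi p : #|supp chi| = m.+2 -> p \in supp chi ->
  (#|[pred q | (q != p) && (chi q + chi p == 0)%R]| <= m.+2)%N.
Proof.
move=> c p_supp; rewrite -c; apply: subset_leq_card; apply/subsetP => q /andP[_ h].
exact: opp_supp h.
Qed.

Lemma opp_term_le chi p q : #|supp chi| = m.+2 -> p \in supp chi ->
  (q != p) && (chi q + chi p == 0) -> `|a (move chi p q)| * N ^+ k <= K2.
Proof.
move=> c p_supp /andP[qp h]; apply: hK2.
by rewrite card_supp_move ?(opp_supp p_supp h) // h c subn2.
Qed.

Lemma opp_sqr_le chi p : #|supp chi| = m.+2 -> p \in supp chi ->
  opp_sum chi p ^+ 2 <= m.+2%:R * \sum_(q | (q != p) && (chi q + chi p == 0)) a (move chi p q) ^+ 2.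
Proof.
move=> c p_supp; apply: le_trans (sqr_sum_le _ _) _.
rewrite ler_wpM2r ?ler_nat ?card_opp_le // sumr_ge0 // => q _; exact: sqr_ge0.
Qed.

(* Off-diagonal terms only occur when two coordinates of chi equal - chi p; after removing one of them,
   the other still takes the value - chi p. *)
Lemma opp_cube_le chi p : #|supp chi| = m.+2 -> p \in supp chi ->
  `|opp_sum chi p ^+ 3 - \sum_(q | (q != p) && (chi q + chi p == 0)) a (move chi p q) ^+ 3| * N ^+ k <=
  2 * m.+2%:R ^+ 2 * K2 * \sum_(q | (q != p) && (chi q + chi p == 0))
    a (move chi p q) ^+ 2 * [exists q', move chi p q q' == - chi p]%:R.
Proof.
move=> c p_supp; pose P q := (q != p) && (chi q + chi p == 0); pose x q := a (move chi p q).
have Nk_ge0 : 0 <= N ^+ k by rewrite exprn_ge0.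
have rhs_ge0 : 0 <= 2 * m.+2%:R ^+ 2 * K2 * \sum_(q | P q) x q ^+ 2 * [exists q', move chi p q q' == - chi p]%:R.
  rewrite !mulr_ge0 ?exprn_ge0 //; apply: sumr_ge0 => q _.
  by rewrite mulr_ge0 ?sqr_ge0 ?ler0n.
have [/existsP[q1 /existsP[q2 /and3P[Pq1 Pq2 q12]]]|uniq_q] :=
  boolP [exists q1, exists q2, [&& P q1, P q2 & q1 != q2]]; last first.
  suff -> : opp_sum chi p ^+ 3 - \sum_(q | P q) x q ^+ 3 = 0 by rewrite normr0 mul0r.
  have [q0 Pq0|none] := pickP P; last by rewrite /opp_sum !big_pred0 // expr0n subrr.
  have P1 q : P q = (q == q0).
    apply/idP/eqP => [Pq|->//]; apply/eqP; apply: contraNT uniq_q => qq0.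
    by apply/existsP; exists q; apply/existsP; exists q0; rewrite Pq Pq0.
  by rewrite /opp_sum !(big_pred1 q0) // subrr.
have two q : P q -> [exists q', move chi p q q' == - chi p].
  move=> Pq; have [q' Pq' q'q] : exists2 q', P q' & q' != q.
    by have [<-|] := eqVneq q1 q; [exists q2 => //; rewrite eq_sym | exists q1].
  apply/existsP; exists q'; rewrite ffunE (negPf q'q) addr0.
  by case/andP: Pq' => -> h; rewrite -addr_eq0.
rewrite [X in _ <= _ * X](eq_bigr (fun q => x q ^+ 2)) => [|q /two ->]; last by rewrite mulr1.
set S := \sum_(q | P q) x q ^+ 2.
have S_ge0 : 0 <= S by apply: sumr_ge0 => q _; apply: sqr_ge0.
have m2_ge1 : 1 <= m.+2%:R :> R by rewrite ler1n.
have cubes : `|\sum_(q | P q) x q ^+ 3| * N ^+ k <= K2 * S.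
  apply: le_trans (ler_wpM2r Nk_ge0 (ler_norm_sum _ _ _)) _.
  rewrite mulr_suml mulr_sumr; apply: ler_sum => q Pq.
  by rewrite normrX norm_cube mulrAC ler_wpM2r ?sqr_ge0 // opp_term_le.
have lin : `|opp_sum chi p| * N ^+ k <= m.+2%:R * K2.
  apply: le_trans (ler_wpM2r Nk_ge0 (ler_norm_sum _ _ _)) _; rewrite mulr_suml.
  apply: (@le_trans _ _ (\sum_(q | P q) K2)); first by apply: ler_sum => q Pq; apply: opp_term_le.
  by rewrite sumr_const -[X in X <= _]mulr_natl ler_wpM2r // ler_nat card_opp_le.
have whole : `|opp_sum chi p ^+ 3| * N ^+ k <= m.+2%:R * K2 * (m.+2%:R * S).
  rewrite normrX norm_cube mulrAC; apply: (ler_pM _ (sqr_ge0 _) lin (opp_sqr_le c p_supp)).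
  by rewrite mulr_ge0.
apply: le_trans (ler_wpM2r Nk_ge0 (ler_normB _ _)) _; rewrite mulrDl.
apply: le_trans (lerD whole cubes) _.
have KS_ge0 : 0 <= K2 * S by rewrite mulr_ge0.
have -> : m.+2%:R * K2 * (m.+2%:R * S) + K2 * S = (m.+2%:R ^+ 2 + 1) * (K2 * S) by ring.
rewrite -[X in _ <= X]mulrA ler_wpM2r // mulr2n mulrDl mul1r lerD2l.
by rewrite exprn_ege1.
Qed.

Lemma sum_opposite_pow j :
  \sum_(chi | #|supp chi| == m.+2) \sum_(p | p \in supp chi)
    \sum_(q | (q != p) && (chi q + chi p == 0)) a (move chi p q) ^+ j =
  (N - m%:R) * D * (N - 1) * \sum_(psi | #|supp psi| == m) a psi ^+ j.
Proof.
rewrite (sum_opposite_pairs m (fun psi _ => a psi ^+ j)) -!mulrA; congr (_ * (_ * _)).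
rewrite mulr_sumr; apply: eq_bigr => psi _; rewrite sumr_const -[LHS]mulr_natl; congr (_ * _).
have -> : #|(fun v : V => v != 0)| = #|predC1 (0 : V)| by apply: eq_card.
by rewrite cardC1 (bs_card a_spec) -subn1 natrB.
Qed.

(** Of the n - 1 nontrivial v, few are opposite to a value of psi. This saves the factor n that
    makes the off-diagonal terms of [opp_cube_le] negligible. *)
Lemma sum_value_le psi : \sum_(v : V | v != 0) ([exists q', psi q' == - v])%:R <= #|supp psi|%:R :> R.
Proof.
rewrite -natr_sum ler_nat -big_mkcondr /= sum1dep_card.
apply: leq_trans (leq_imset_card (fun q => - psi q) (supp psi)).
apply/subset_leq_card/subsetP => v; rewrite inE => /andP[v0 /existsP[q /eqP psiq]].
by apply/imsetP; exists q; rewrite ?in_supp psiq ?oppr_eq0 ?opprK.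
Qed.

Lemma D_bounds : 0 <= D <= N.
Proof.
have h : m.+2%:R <= N by rewrite ler_nat.
rewrite -[m.+2]addn2 natrD in h; have := ler0n R m => m_ge0; apply/andP; split; lra.
Qed.

(** [merge_split] is cubed and summed over chi and p. Dropping [rest_sum] costs [boundA], and
    replacing the cube of [opp_sum] by the sum of the cubes of its terms costs [boundB]; both are
    O(n^2), against coefficients of order n^3. *)
Lemma even_step :
  `|D ^+ 3 * m.+2%:R * cube_sum m.+2 + (N - m%:R) * D * (N - 1) * cube_sum m| <=
  (15 * m.+2%:R ^+ 2 * K1 + 2 * m.+2%:R ^+ 2 * m%:R * K2) * 9 ^+ k * N ^+ 2.
Proof.
have /andP[D_ge0 D_le] := D_bounds.
have N_gt0 : 0 < N by rewrite ltr0n.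
have Nk_gt0 := natrX_gt0 R n_gt0 k.
have m2_ge0 : 0 <= m.+2%:R :> R by [].
have Nm_ge0 : 0 <= N - m%:R by lra.
have Nm_le : N - m%:R <= N by rewrite gerBl.
have N1_ge0 : 0 <= N - 1 by rewrite subr_ge0 ler1n.
have N1_le : N - 1 <= N by rewrite gerBl.
have mass_m := mass_even k.
have mass_m2 : mass a m.+2 <= 9 ^+ k.+1 * N ^+ k.+1.
  have -> : m.+2 = (2 * k.+1)%N by rewrite mulnS.
  exact: mass_even.
pose u chi : R := - (D * a chi).
pose x3 chi p := \sum_(q | (q != p) && (chi q + chi p == 0)) a (move chi p q) ^+ 3.
have -> : D ^+ 3 * m.+2%:R * cube_sum m.+2 + (N - m%:R) * D * (N - 1) * cube_sum m =
    - (\sum_(chi | #|supp chi| == m.+2) \sum_(p | p \in supp chi) (u chi ^+ 3 - opp_sum chi p ^+ 3))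
    - \sum_(chi | #|supp chi| == m.+2) \sum_(p | p \in supp chi) (opp_sum chi p ^+ 3 - x3 chi p).
  rewrite -(sum_opposite_pow 3) -opprD -big_split /=.
  have -> : D ^+ 3 * m.+2%:R * cube_sum m.+2 =
      - \sum_(chi | #|supp chi| == m.+2) \sum_(p | p \in supp chi) u chi ^+ 3.
    rewrite mulr_sumr -sumrN; apply: eq_bigr => chi /eqP c.
    by rewrite sumr_const c -mulr_natl /u; ring.
  rewrite addrC -opprB; congr (- _); rewrite -sumrB; apply: eq_bigr => chi _.
  rewrite -big_split -sumrB; apply: eq_bigr => p _ /=.
  by rewrite addrA subrK.
(* The constant is 15 = 3/2 (9 + 1): 3/2 from [norm_subX3], 9 from the mass at size m + 2, and 1
   from the squares of [opp_sum]. *)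
have boundA : `|\sum_(chi | #|supp chi| == m.+2) \sum_(p | p \in supp chi) (u chi ^+ 3 - opp_sum chi p ^+ 3)|
    <= 15 * m.+2%:R ^+ 2 * K1 * 9 ^+ k * N ^+ 2.
  have pt chi p : #|supp chi| = m.+2 -> p \in supp chi ->
      `|u chi ^+ 3 - opp_sum chi p ^+ 3| * N ^+ k.+1 <=
      3 / 2 * (m.+2%:R * K1) * (D ^+ 2 * a chi ^+ 2 + opp_sum chi p ^+ 2).
    move=> c p_supp; have Nk1_ge0 : 0 <= N ^+ k.+1 by rewrite exprn_ge0.
    apply: le_trans (ler_wpM2r Nk1_ge0 (norm_subX3 _ _)) _.
    have -> : u chi - opp_sum chi p = rest_sum chi p by rewrite /u (merge_split c p_supp) addrC addKr.
    have -> : u chi ^+ 2 = D ^+ 2 * a chi ^+ 2 by rewrite /u sqrrN exprMn.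
    have w_ge0 : 0 <= D ^+ 2 * a chi ^+ 2 + opp_sum chi p ^+ 2.
      exact: (addr_ge0 (mulr_ge0 (sqr_ge0 _) (sqr_ge0 _)) (sqr_ge0 _)).
    rewrite mulrAC ler_wpM2r // -[X in X <= _]mulrA; apply: ler_wpM2l; first by rewrite divr_ge0.
    exact: rest_le.
  have Nk1_gt0 := natrX_gt0 R n_gt0 k.+1.
  rewrite -(ler_pM2r Nk1_gt0).
  apply: le_trans (ler_wpM2r (ltW Nk1_gt0) (ler_norm_sum _ _ _)) _; rewrite mulr_suml.
  apply: (@le_trans _ _ (\sum_(chi | #|supp chi| == m.+2) \sum_(p | p \in supp chi)
      3 / 2 * (m.+2%:R * K1) * (D ^+ 2 * a chi ^+ 2 + opp_sum chi p ^+ 2))).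
    apply: ler_sum => chi /eqP c.
    apply: le_trans (ler_wpM2r (ltW Nk1_gt0) (ler_norm_sum _ _ _)) _; rewrite mulr_suml.
    by apply: ler_sum => p p_supp; apply: pt.
  have sumE : \sum_(chi | #|supp chi| == m.+2) \sum_(p | p \in supp chi)
      3 / 2 * (m.+2%:R * K1) * (D ^+ 2 * a chi ^+ 2 + opp_sum chi p ^+ 2) =
      3 / 2 * (m.+2%:R * K1) * (D ^+ 2 * m.+2%:R * mass a m.+2 +
        \sum_(chi | #|supp chi| == m.+2) \sum_(p | p \in supp chi) opp_sum chi p ^+ 2).
    rewrite /mass [X in _ = _ * (X + _)]mulr_sumr -big_split mulr_sumr /=; apply: eq_bigr => chi /eqP c.
    rewrite -mulr_sumr big_split sumr_const c /=; congr (_ * (_ + _)).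
    by rewrite -[LHS]mulr_natr mulrAC.
  have sqs : \sum_(chi | #|supp chi| == m.+2) \sum_(p | p \in supp chi) opp_sum chi p ^+ 2 <=
      m.+2%:R * (N ^+ 3 * (9 ^+ k * N ^+ k)).
    apply: (@le_trans _ _ (m.+2%:R * ((N - m%:R) * D * (N - 1) * mass a m))).
      rewrite /mass -sum_opposite_pow mulr_sumr; apply: ler_sum => chi /eqP c.
      by rewrite mulr_sumr; apply: ler_sum => p p_supp; apply: opp_sqr_le.
    rewrite ler_wpM2l // ler_pM ?mass_ge0 ?mulr_ge0 // !exprSr expr0 mul1r.
    by rewrite ler_pM ?mulr_ge0 // ler_pM.
  rewrite sumE.
  have first_le : D ^+ 2 * m.+2%:R * mass a m.+2 <= N ^+ 2 * m.+2%:R * (9 ^+ k.+1 * N ^+ k.+1).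
    rewrite ler_pM ?mass_ge0 ?mulr_ge0 ?sqr_ge0 // ler_wpM2r //.
    by rewrite lerXn2r ?nnegrE // ltW.
  apply: le_trans (ler_wpM2l _ (lerD first_le sqs)) _; first by rewrite !mulr_ge0 ?invr_ge0.
  by rewrite le_eqVlt; apply/orP; left; apply/eqP; rewrite !exprS; field.
have boundB : `|\sum_(chi | #|supp chi| == m.+2) \sum_(p | p \in supp chi) (opp_sum chi p ^+ 3 - x3 chi p)|
    <= 2 * m.+2%:R ^+ 2 * m%:R * K2 * 9 ^+ k * N ^+ 2.
  rewrite -(ler_pM2r Nk_gt0).
  apply: le_trans (ler_wpM2r (ltW Nk_gt0) (ler_norm_sum _ _ _)) _; rewrite mulr_suml.
  apply: (@le_trans _ _ (\sum_(chi | #|supp chi| == m.+2) \sum_(p | p \in supp chi)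
      2 * m.+2%:R ^+ 2 * K2 * \sum_(q | (q != p) && (chi q + chi p == 0))
        a (move chi p q) ^+ 2 * [exists q', move chi p q q' == - chi p]%:R)).
    apply: ler_sum => chi /eqP c.
    apply: le_trans (ler_wpM2r (ltW Nk_gt0) (ler_norm_sum _ _ _)) _; rewrite mulr_suml.
    by apply: ler_sum => p p_supp; apply: opp_cube_le.
  under eq_bigr do rewrite -mulr_sumr.
  rewrite -mulr_sumr.
  rewrite (sum_opposite_pairs m (fun psi v => a psi ^+ 2 * [exists q', psi q' == - v]%:R)).
  have inner : \sum_(psi | #|supp psi| == m) \sum_(v | v != 0) a psi ^+ 2 * [exists q', psi q' == - v]%:R
      <= m%:R * (9 ^+ k * N ^+ k).
    apply: (@le_trans _ _ (m%:R * mass a m)); last by rewrite ler_wpM2l.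
    rewrite /mass mulr_sumr; apply: ler_sum => psi /eqP c.
    by rewrite -mulr_sumr mulrC ler_wpM2r ?sqr_ge0 // -c sum_value_le.
  have c_ge0 : 0 <= 2 * m.+2%:R ^+ 2 * K2 by rewrite !mulr_ge0 // exprn_ge0.
  have N2 : (N - m%:R) * D <= N ^+ 2 by rewrite expr2 ler_pM.
  apply: le_trans (ler_wpM2l c_ge0 (ler_wpM2l (mulr_ge0 Nm_ge0 D_ge0) inner)) _.
  have i_ge0 : 0 <= m%:R * (9 ^+ k * N ^+ k) by rewrite !mulr_ge0 ?exprn_ge0.
  apply: le_trans (ler_wpM2l c_ge0 (ler_wpM2r i_ge0 N2)) _.
  by rewrite le_eqVlt; apply/orP; left; apply/eqP; ring.
apply: le_trans (ler_normB _ _) _; rewrite normrN; apply: le_trans (lerD boundA boundB) _.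
by rewrite le_eqVlt; apply/orP; left; apply/eqP; ring.
Qed.

End Step.
End EvenStep.

(** * Limits of the cube sums at bounded size *)

Section Limits.
Variable R : realType.

Definition cube_sum_limit (k : nat) : R := (- 2^-1) ^+ k / k`!%:R.

Lemma cube_sum_limitS k : cube_sum_limit k.+1 = - cube_sum_limit k / (2 * k)%N.+2%:R.
Proof.
rewrite /cube_sum_limit factS natrM exprS.
have -> : (2 * k)%N.+2%:R = 2 * k.+1%:R :> R by rewrite -natrM mulnS.
by rewrite !invfM; ring.
Qed.

Lemma cube_sum_limit_norm k : `|cube_sum_limit k| <= 1.
Proof.
elim: k => [|k IHk]; first by rewrite /cube_sum_limit expr0 fact0 divr1 normr1.
rewrite cube_sum_limitS normrM normrN normfV normr_nat ler_pdivrMr ?ltr0n //.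
by apply: le_trans IHk _; rewrite mul1r ler1n.
Qed.

Lemma cube_sum0 n (V : finZmodType) (a : {ffun 'I_n -> V} -> R) : bij_spectrum a -> cube_sum a 0 = 1.
Proof.
move=> a_spec; rewrite /cube_sum (big_pred1 (0 : {ffun 'I_n -> V})) ?(bs_zero a_spec) ?expr1n // => chi.
apply/eqP/eqP => [/supp0P //|->]; apply/eqP; rewrite cards_eq0.
by apply/eqP/setP => i; rewrite in_supp ffunE eqxx inE.
Qed.

(** With D = N - m - 1, the product (N - m)(N - 1) differs from D^2 by at most (m + 1) N, so
    division by D^3 leaves (m + 2) y + x = O(1/N). The constants 8 and 4 come from D >= N/2. *)
Lemma even_step_limit (N m x y C t c : R) :
  0 < N -> 1 <= N -> 0 <= m -> 2 * m + 2 <= N -> 0 <= C -> 0 <= c ->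
  `|(N - m - 1) ^+ 3 * (m + 2) * y + (N - m) * (N - m - 1) * (N - 1) * x| <= C * N ^+ 2 ->
  `|x - t| * N <= c -> `|t| <= 1 ->
  `|y - - t / (m + 2)| * N <= 8 * C + 4 * (m + 1) * (1 + c) + c.
Proof.
move=> N_gt0 N_ge1 m_ge0 N_large C_ge0 c_ge0 step x_near t_le.
pose D := N - m - 1.
have D_gt0 : 0 < D by rewrite /D; lra.
have D_half : N / 2 <= D by rewrite /D; lra.
have N2_ge0 : 0 <= N / 2 by lra.
have x_le : `|x| <= 1 + c.
  have -> : x = t + (x - t) by ring.
  apply: le_trans (ler_normD _ _) _; apply: lerD => //.
  by apply: le_trans x_near; rewrite ler_peMr.
have D2 : N ^+ 2 / 4 <= D ^+ 2.
  have -> : N ^+ 2 / 4 = (N / 2) ^+ 2 by field.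
  by rewrite lerXn2r ?nnegrE // ltW.
have D3 : N ^+ 3 / 8 <= D ^+ 3.
  have -> : N ^+ 3 / 8 = (N / 2) ^+ 3 by field.
  by rewrite lerXn2r ?nnegrE // ltW.
have main : `|(m + 2) * y + x| * N <= 8 * C + 4 * (m + 1) * (1 + c).
  have split_id : D ^+ 3 * ((m + 2) * y + x) =
      (D ^+ 3 * (m + 2) * y + (N - m) * D * (N - 1) * x) - D * ((m + 1) * N + m - (m + 1) ^+ 2) * x.
    by rewrite /D; ring.
  have w_le : `|(m + 1) * N + m - (m + 1) ^+ 2| <= (m + 1) * N.
    rewrite ler_norml; apply/andP; split; nra.
  have h1 : `|D ^+ 3 * ((m + 2) * y + x)| <= C * N ^+ 2 + D * ((m + 1) * N) * (1 + c).
    rewrite split_id; apply: le_trans (ler_normB _ _) _; apply: lerD; first exact: step.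
    rewrite !normrM (gtr0_norm D_gt0); apply: ler_pM => //; first exact: mulr_ge0 (ltW D_gt0) _.
    exact: ler_wpM2l (ltW D_gt0) _ _ w_le.
  rewrite normrM normrX (gtr0_norm D_gt0) in h1.
  set X := `|(m + 2) * y + x| in h1 *; have X_ge0 : 0 <= X by apply: normr_ge0.
  have h2 : D ^+ 3 * (X * N) <= D ^+ 3 * (8 * C + 4 * (m + 1) * (1 + c)).
    have -> : D ^+ 3 * (X * N) = (D ^+ 3 * X) * N by ring.
    apply: le_trans (ler_wpM2r (ltW N_gt0) h1) _.
    have a1 : C * N ^+ 2 * N <= D ^+ 3 * (8 * C).
      have -> : C * N ^+ 2 * N = 8 * (N ^+ 3 / 8 * C) by field.
      have -> : D ^+ 3 * (8 * C) = 8 * (D ^+ 3 * C) by ring.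
      by rewrite ler_wpM2l // ler_wpM2r.
    have a2 : D * ((m + 1) * N) * (1 + c) * N <= D ^+ 3 * (4 * (m + 1) * (1 + c)).
      have p_ge0 : 0 <= D * (m + 1) * (1 + c) by rewrite (mulr_ge0 (mulr_ge0 (ltW D_gt0) _)) // addr_ge0.
      have -> : D * ((m + 1) * N) * (1 + c) * N = 4 * (N ^+ 2 / 4 * (D * (m + 1) * (1 + c))) by field.
      have -> : D ^+ 3 * (4 * (m + 1) * (1 + c)) = 4 * (D ^+ 2 * (D * (m + 1) * (1 + c))) by ring.
      by rewrite ler_wpM2l // ler_wpM2r.
    by rewrite mulrDl [X in _ <= X]mulrDr lerD.
  by rewrite ler_pM2l ?exprn_gt0 in h2.
have m2_gt0 : 0 < m + 2 by lra.
have -> : y - - t / (m + 2) = (((m + 2) * y + x) - (x - t)) / (m + 2) by field; rewrite gt_eqF.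
rewrite normrM normfV (gtr0_norm m2_gt0) mulrAC ler_pdivrMr //.
apply: (@le_trans _ _ (8 * C + 4 * (m + 1) * (1 + c) + c)).
  apply: le_trans (ler_wpM2r (ltW N_gt0) (ler_normB _ _)) _.
  by rewrite mulrDl lerD.
rewrite ler_peMr //; last by lra.
rewrite addr_ge0 // addr_ge0 //; first by rewrite mulr_ge0.
by rewrite !mulr_ge0 // addr_ge0.
Qed.

Lemma cube_sum_even (k : nat) : exists2 C : R, 0 <= C &
  forall n (V : finZmodType) (a : {ffun 'I_n -> V} -> R), bij_spectrum a ->
  (0 < n)%N -> (4 * k <= n)%N -> `|cube_sum a (2 * k)%N - cube_sum_limit k| * n%:R <= C.
Proof.
elim: k => [|k [c c_ge0 hc]].
  exists 0 => // n V a a_spec _ _.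
  by rewrite muln0 (cube_sum0 a_spec) /cube_sum_limit expr0 fact0 divr1 subrr normr0 mul0r.
have [K1 K1_ge0 hK1] := sup_fixed R (2 * k)%N.+1.
have [K2 K2_ge0 hK2] := sup_fixed R (2 * k)%N.
pose C : R := (15 * (2 * k)%N.+2%:R ^+ 2 * K1 + 2 * (2 * k)%N.+2%:R ^+ 2 * (2 * k)%N%:R * K2) * 9 ^+ k.
have C_ge0 : 0 <= C by rewrite mulr_ge0 ?exprn_ge0 // addr_ge0 // !mulr_ge0 // exprn_ge0.
pose m : R := (2 * k)%N%:R; have m_ge0 : 0 <= m by apply: ler0n.
exists (8 * C + 4 * (m + 1) * (1 + c) + c).
  rewrite addr_ge0 // addr_ge0 //; first by rewrite mulr_ge0.
  by rewrite !mulr_ge0 // addr_ge0.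
move=> n V a a_spec n_gt0 nk.
have mE : m + 2 = (2 * k)%N.+2%:R by rewrite -[(2 * k)%N.+2]addn2 natrD.
rewrite cube_sum_limitS -mE.
have -> : (2 * k.+1 = (2 * k).+2)%N by lia.
have u1 : uphalf (2 * k)%N.+1 = k.+1 by rewrite /= mul2n doubleK.
have u2 : uphalf (2 * k)%N = k by rewrite mul2n uphalf_double.
apply: (@even_step_limit _ m (cube_sum a (2 * k)%N)) => //.
- by rewrite ltr0n.
- by rewrite ler1n.
- by rewrite /m -natrM -natrD ler_nat; lia.
- rewrite mE; apply: (even_step a_spec n_gt0) => //; first by lia.
    by move=> chi c1; have := hK1 _ _ _ a_spec n_gt0 _ chi c1; rewrite u1; apply; lia.
  by move=> chi c1; have := hK2 _ _ _ a_spec n_gt0 _ chi c1; rewrite u2; apply; lia.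
- by apply: hc => //; lia.
exact: cube_sum_limit_norm.
Qed.

(** Sizes are taken in pairs 2k, 2k + 1: the even one supplies the limit with error O(1/n), the odd
    one vanishes as n^(-1/2) and fixes the rate. *)
Lemma cube_sum_pairs (J : nat) : exists2 C : R, 0 <= C &
  forall n (V : finZmodType) (a : {ffun 'I_n -> V} -> R), bij_spectrum a ->
  (0 < n)%N -> (4 * J <= n)%N ->
  `|\sum_(m < (2 * J)%N) cube_sum a m - \sum_(k < J) cube_sum_limit k| * Num.sqrt n%:R <= C.
Proof.
elim: J => [|J [C C_ge0 hC]].
  by exists 0 => // n V a _ _ _; rewrite muln0 !big_ord0 subrr normr0 mul0r.
have [C1 C1_ge0 hC1] := cube_sum_even J.
have [K K_ge0 hK] := sup_fixed R (2 * J)%N.+1.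
exists (C + C1 + K * 3 ^+ (2 * J)%N.+1); first by rewrite !addr_ge0 // mulr_ge0 // exprn_ge0.
move=> n V a a_spec n_gt0 nJ.
have -> : (2 * J.+1 = (2 * J).+2)%N by lia.
rewrite !big_ord_recr /=.
have s_ge0 := sqrtr_ge0 (n%:R : R).
have s_le : Num.sqrt n%:R <= n%:R :> R.
  have s1 : 1 <= Num.sqrt n%:R :> R by rewrite -[X in X <= _]sqrtr1 ler_wsqrtr ?ler1n.
  by rewrite -{2}[n%:R]sqr_sqrtr // expr2 ler_peMr.
have h1 : `|cube_sum a (2 * J)%N - cube_sum_limit J| * Num.sqrt n%:R <= C1.
  apply: (@le_trans _ _ (`|cube_sum a (2 * J)%N - cube_sum_limit J| * n%:R)); first by rewrite ler_wpM2l.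
  by apply: hC1 => //; lia.
have h2 : `|cube_sum a (2 * J)%N.+1| * Num.sqrt n%:R <= K * 3 ^+ (2 * J)%N.+1.
  apply: (cube_sum_odd a_spec n_gt0) => // chi c1.
  have := hK _ _ _ a_spec n_gt0 _ chi c1; have -> : uphalf (2 * J)%N.+1 = J.+1 by rewrite /= mul2n doubleK.
  by apply; lia.
have h0 : `|\sum_(m < (2 * J)%N) cube_sum a m - \sum_(k < J) cube_sum_limit k| * Num.sqrt n%:R <= C.
  by apply: hC => //; lia.
move: (\sum_(m < (2 * J)%N) cube_sum a m) (\sum_(k < J) cube_sum_limit k) h0 => S L h0.
have -> : S + cube_sum a (2 * J)%N + cube_sum a (2 * J)%N.+1 - (L + cube_sum_limit J) =
   (S - L) + (cube_sum a (2 * J)%N - cube_sum_limit J) + cube_sum a (2 * J)%N.+1 by ring.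
apply: (@le_trans _ _ ((`|S - L| + `|cube_sum a (2 * J)%N - cube_sum_limit J| + `|cube_sum a (2 * J)%N.+1|) * Num.sqrt n%:R)).
  rewrite ler_wpM2r //; apply: le_trans (ler_normD _ _) _; rewrite lerD2r; exact: ler_normD.
by rewrite !mulrDl !lerD.
Qed.

Import numFieldNormedType.Exports.

Lemma cube_sum_limit_series (eps : R) : 0 < eps ->
  exists J0, forall J, (J0 <= J)%N -> `|\sum_(k < J) cube_sum_limit k - expR (- 2^-1)| <= eps.
Proof.
move=> eps_gt0.
have cvg_exp : (series (exp_coeff (- 2^-1 : R)) @ \oo --> expR (- 2^-1 : R))%classic.
  exact: is_cvg_series_exp_coeff.
have /cvgrPdist_le/(_ _ eps_gt0) := cvg_exp.
case=> J0 _ h; exists J0 => J /h; rewrite distrC /= => h'.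
suff <- : series (exp_coeff (- 2^-1)) J = \sum_(k < J) cube_sum_limit k :> R by [].
by rewrite /series /= big_mkord; apply: eq_bigr => k _.
Qed.

End Limits.

(** * The limit *)

Section Assembly.
Variables (R : realType) (n : nat) (V : finZmodType) (a : {ffun 'I_n -> V} -> R).
Hypothesis a_spec : bij_spectrum a.
Hypothesis n_gt0 : (0 < n)%N.
Local Notation freq := {ffun 'I_n -> V}.
Local Notation e := (expR 1 : R).
Implicit Types (chi : freq).

(** With z = (m/n)^(1/4), the upper bound on m is what makes 2 e^7 z <= 1/2 in [sum_few_colours];
    the lower bound is that of [sum_many_colours]. *)
Lemma cube_sum_sparse (m : nat) : (0 < m)%N -> 2 ^+ 8 * 3 ^+ 8 * e ^+ 19 <= m%:R ->
  m%:R <= (4 * e ^+ 7) ^- 4 * n%:R -> `|cube_sum a m| <= 2 * 2^-1 ^+ m.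
Proof.
move=> m_gt0 m_large m_small.
have n_pos : 0 < n%:R :> R by rewrite ltr0n.
have m_pos : 0 < m%:R :> R by rewrite ltr0n.
have e7_ge1 : 1 <= e ^+ 7 by apply: e_pow_ge1.
have b_gt0 : 0 < 4 * e ^+ 7 by lra.
pose z := Num.sqrt (Num.sqrt (m%:R / n%:R : R)).
have z4 : z ^+ 4 = m%:R / n%:R.
  by rewrite -[4%N]/(2 * 2)%N exprM sqr_sqrtr ?sqrtr_ge0 // sqr_sqrtr // divr_ge0.
have z_gt0 : 0 < z by rewrite !sqrtr_gt0 divr_gt0.
have z_le : z <= (4 * e ^+ 7)^-1.
  rewrite -(@ler_pXn2r _ 4) ?nnegrE ?invr_ge0 ?(ltW z_gt0) ?(ltW b_gt0) //.
  by rewrite z4 exprVn ler_pdivrMr.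
have zb : z * (4 * e ^+ 7) <= 1 by rewrite -ler_pdivlMr // div1r.
have z_le1 : z <= 1.
  apply: le_trans zb; rewrite ler_peMr //; [exact: ltW | lra].
have mn : (m <= n)%N.
  have : z ^+ 4 <= 1 by rewrite exprn_ile1 // ltW.
  by rewrite z4 ler_pdivrMr // mul1r ler_nat.
apply: le_trans (ler_norm_sum _ _ _) _.
rewrite (bigID (fun chi => (4 * ncolours chi <= m)%N)) /=.
rewrite [X in _ <= X](_ : _ = 2^-1 ^+ m + 2^-1 ^+ m); last by rewrite -mulr2n mulr_natl.
under eq_bigr do rewrite normrX.
under [X in _ + X]eq_bigr do rewrite normrX.
apply: lerD.
  apply: le_trans (sum_few_colours a_spec n_gt0 mn _ z4) _; first by rewrite z_gt0.
  have w_ge0 : 0 <= 2 * e ^+ 7 * z by rewrite !mulr_ge0 ?exprn_ge0 ?expR_ge0 // ltW.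
  have w_le : 2 * e ^+ 7 * z <= 2^-1.
    have -> : 2 * e ^+ 7 * z = z * (4 * e ^+ 7) / 2 by field.
    by rewrite -[X in _ <= X]mul1r ler_wpM2r ?invr_ge0.
  by rewrite lerXn2r ?nnegrE ?invr_ge0.
under eq_bigl do rewrite -ltnNge.
exact: sum_many_colours.
Qed.

Lemma sum_spread (c d : R) (L : nat) : 0 < c < 1 -> d = c / 24 -> d ^- 5 <= expR (c / 8 * L%:R) ->
  (d ^- 2 * expR (2 * d) * e ^+ 3) ^+ L <= n%:R ->
  `|\sum_(chi | spread c chi) a chi ^+ 3| <= 2.
Proof.
move=> c01 dE L_large n_large; apply: le_trans (ler_norm_sum _ _ _) _.
under eq_bigr do rewrite normrX.
rewrite (bigID (fun chi => (all_colours chi * L <= n)%N)) /=.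
have d01 : 0 < d < 1 by move: c01 => /andP[c0 c1]; rewrite dE; apply/andP; split; lra.
have := lerD (spread_few a_spec n_gt0 c01 dE L_large) (spread_many a_spec n_gt0 d01 n_large).
move=> h; apply: le_trans (le_trans _ h) _; last by lra.
rewrite lerD2l [X in X <= _]big_mkcond [X in _ <= X]big_mkcond /=; apply: ler_sum => chi _.
by rewrite -ltnNge; case: (spread c chi); case: ifP => //= _; rewrite exprn_ge0.
Qed.

Definition majority (c : R) (v : V) chi := (1 - c) * n%:R < (occ chi v)%:R.

Lemma sum_majority_shift c v :
  \sum_(chi | majority c v chi) a chi ^+ 3 = \sum_(chi | majority c 0 chi) a chi ^+ 3.
Proof.
have shift_inj : injective (fun chi : freq => [ffun i => chi i + v]).
  by move=> f g /ffunP h; apply/ffunP => i; have := h i; rewrite !ffunE => /addIr.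
rewrite (reindex_inj shift_inj) /=; apply: eq_big => [chi|chi _]; last by rewrite bs_shift.
rewrite /majority; congr (_ < _%:R); apply: eq_card => i.
by rewrite !inE ffunE -subr_eq0 addrK.
Qed.

(** As c < 1/2, at most one character occupies more than (1 - c) n positions, and by
    [sum_majority_shift] each of the n candidates contributes as much as the trivial one. *)
Lemma sum_majority (c : R) : 0 < c < 2^-1 ->
  \sum_(chi | ~~ spread c chi) a chi ^+ 3 =
  n%:R * \sum_(m < n.+1 | m%:R < c * n%:R) cube_sum a m.
Proof.
move=> /andP[c_gt0 c_lt].
have n_pos : 0 < n%:R :> R by rewrite ltr0n.
have uniq_v chi u v : majority c u chi -> majority c v chi -> u = v.
  move=> hu hv; apply/eqP; apply: contraT => uv.
  have : (occ chi u + occ chi v <= n)%N.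
    rewrite -[X in (_ <= X)%N](sum_occ chi) (bigD1 u) //= (bigD1 v) //= 1?eq_sym // addnA.
    exact: leq_addr.
  rewrite -(ler_nat R) natrD => h; move: hu hv; rewrite /majority; nra.
have -> : \sum_(chi | ~~ spread c chi) a chi ^+ 3 = \sum_v \sum_(chi | majority c v chi) a chi ^+ 3.
  rewrite (exchange_big_dep predT) //= big_mkcond; apply: eq_bigr => chi _.
  rewrite /spread negb_forall; case: existsP => [[v hv]|none].
    rewrite -ltNge in hv; rewrite (big_pred1 v) // => u.
    by apply/idP/eqP => [hu|->//]; apply: uniq_v hu hv.
  by rewrite big_pred0 // => v; apply/negP => hv; apply: none; exists v; rewrite -ltNge.
rewrite (eq_bigr _ (fun v _ => sum_majority_shift c v)) sumr_const.
have -> : #|V| = n by apply: bs_card a_spec.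
rewrite -[LHS]mulr_natl; congr (_ * _).
rewrite (partition_big (fun chi => inord #|supp chi| : 'I_n.+1) (fun m => m%:R < c * n%:R)) /=.
  apply: eq_bigr => m mc; apply: eq_bigl => chi.
  have -> : (inord #|supp chi| == m :> 'I_n.+1) = (#|supp chi| == m).
    by rewrite -val_eqE /= inordK // ltnS supp_le.
  apply/andP/eqP => [[_ /eqP //]|cm]; split; last by apply/eqP.
  have m_le : (m <= n)%N by rewrite -ltnS.
  by rewrite /majority occ0E cm natrB //; lra.
move=> chi; rewrite /majority occ0E natrB ?supp_le // inordK ?ltnS ?supp_le //; lra.
Qed.

End Assembly.

(** * Choice of the parameters and passage to the limit *)

Section Main.
Variable R : realType.
Local Notation e := (expR 1 : R).

Lemma exists_nat_ge (x : R) : exists k : nat, x <= k%:R.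
Proof. by exists (Num.truncn x).+1; apply/ltW/truncnS_gt. Qed.

Lemma half_pow_sum (M k : nat) : \sum_(M <= m < k) (2 * 2^-1 ^+ m) <= 4 * 2^-1 ^+ M :> R.
Proof.
have half_ge0 j : 0 <= 2^-1 ^+ j :> R by rewrite exprn_ge0 ?invr_ge0.
have [Mk|kM] := leqP M k; last by rewrite big_geq ?mulr_ge0 // ltnW.
suff -> : \sum_(M <= m < k) (2 * 2^-1 ^+ m) = 4 * 2^-1 ^+ M - 4 * 2^-1 ^+ k :> R.
  by rewrite gerBl mulr_ge0.
elim: k Mk => [|k IHk]; first by rewrite leqn0 => /eqP ->; rewrite big_geq // subrr.
rewrite leq_eqVlt => /predU1P[->|Mk]; first by rewrite big_geq // subrr.
by rewrite big_nat_recr //= IHk // exprS; move: (2^-1 ^+ M) (2^-1 ^+ k) => u v; lra.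
Qed.

Lemma mean_cube_limit (eps : R) : 0 < eps -> exists n0 : nat,
  forall n (V : finZmodType) (a : {ffun 'I_n -> V} -> R), bij_spectrum a -> (n0 <= n)%N ->
  `|n%:R^-1 * \sum_chi a chi ^+ 3 - expR (- 2^-1)| < eps.
Proof.
move=> eps_gt0.
have e7_ge1 : 1 <= e ^+ 7 by apply: e_pow_ge1.
have b_ge4 : 4 <= 4 * e ^+ 7 by lra.
(* The threshold of [cube_sum_sparse], so that every majority tuple, once shifted, has a size
   covered there or a bounded one. *)
pose c : R := (4 * e ^+ 7) ^- 4.
have c_gt0 : 0 < c by rewrite invr_gt0 exprn_gt0 //; lra.
have c_lt : c < 2^-1.
  rewrite /c ltf_pV2 ?posrE ?exprn_gt0 //; [|by lra].
  have : 4 ^+ 4 <= (4 * e ^+ 7) ^+ 4 by rewrite lerXn2r ?nnegrE //; lra.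
  by apply: lt_le_trans; rewrite -natrX ltr_nat.
pose d := c / 24; have d_gt0 : 0 < d by rewrite divr_gt0.
have [L L_large] : exists L : nat, d ^- 5 <= expR (c / 8 * L%:R).
  have [L hL] := exists_nat_ge (d ^- 5 / (c / 8)); exists L.
  apply: le_trans (expR_ge1Dx _); rewrite -[X in X <= _]add0r lerD //.
  by rewrite mulrC -ler_pdivrMr ?divr_gt0.
(* Four errors of eps/8 each, from the spread part, the tail, the bounded sizes and the truncated
   exponential series, add up to eps/2. *)
have [J1 hJ1] := cube_sum_limit_series (R := R) (eps := eps / 8) ltac:(by rewrite divr_gt0).
have [J2 hJ2] := exists_nat_ge (2 ^+ 8 * 3 ^+ 8 * e ^+ 19).
have [J3 hJ3] := exists_nat_ge (4 / (eps / 8)).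
(* From size 2J on, J2 makes [cube_sum_sparse] applicable, and J3 makes the geometric tail at most
   eps/8. *)
have [J [J1_le J2_le J3_le J_gt0]] : exists J, [/\ (J1 <= J)%N, (J2 <= J)%N, (J3 <= J)%N & (0 < J)%N].
  by exists (maxn J1 (maxn J2 J3)).+1; split; rewrite // ltnW // ltnS !leq_max leqnn ?orbT.
have [M ME] : exists M, M = (2 * J)%N by exists (2 * J)%N.
have JM : (J <= M)%N by rewrite ME leq_pmull.
have M4 : (M <= 4 * J)%N by rewrite ME leq_mul2r orbT.
have [C C_ge0 hC] := cube_sum_pairs R J; rewrite -ME in hC.
have [n1 hn1] := exists_nat_ge ((d ^- 2 * expR (2 * d) * e ^+ 3) ^+ L).
have [n2 hn2] := exists_nat_ge ((C / (eps / 8)) ^+ 2).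
have [n3 hn3] := exists_nat_ge (2 / (eps / 8)).
have [n4 hn4] := exists_nat_ge (M%:R / c).
exists (\max_(i <- [:: n1; n2; n3; n4; (4 * J)%N; 1%N]) i).+1.
move=> n V a a_spec n_large.
have le_n i : i \in [:: n1; n2; n3; n4; (4 * J)%N; 1%N] -> (i < n)%N.
  by move=> i_in; apply: leq_trans n_large; rewrite ltnS; exact: (@leq_bigmax_seq _ _ xpredT id i i_in isT).
have n_gt0 : (0 < n)%N by apply: ltn_trans (le_n 1%N _); rewrite ?inE ?eqxx ?orbT.
have n_pos : 0 < n%:R :> R by rewrite ltr0n.
have large x k : k \in [:: n1; n2; n3; n4; (4 * J)%N; 1%N] -> x <= k%:R -> x <= n%:R :> R.
  by move=> /le_n kn /le_trans; apply; rewrite ler_nat ltnW.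
have g1 := large _ n1 ltac:(by rewrite !inE eqxx) hn1.
have g2 := large _ n2 ltac:(by rewrite !inE eqxx ?orbT) hn2.
have g3 := large _ n3 ltac:(by rewrite !inE eqxx ?orbT) hn3.
have g4 := large _ n4 ltac:(by rewrite !inE eqxx ?orbT) hn4.
have g5 : (4 * J <= n)%N by apply/ltnW/le_n; rewrite !inE eqxx ?orbT.
have M_le : M%:R <= c * n%:R by rewrite mulrC -ler_pdivrMr.
have Mn : (M <= n)%N by apply: leq_trans M4 g5.
have spread_le := sum_spread a_spec n_gt0 (c := c) (d := d) (L := L) _ erefl L_large g1.
have c01 : 0 < c < 1 by rewrite c_gt0 (lt_trans c_lt) // invf_lt1 ?ltr1n.
rewrite (bigID (spread c)) /= sum_majority //; last by rewrite c_gt0.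
rewrite mulrDr mulrA mulVf ?mul1r ?gt_eqF //.
set S := \sum_(m < n.+1 | _) _; set T := \sum_(chi | spread c chi) _ in spread_le *.
have T_le : `|n%:R^-1 * T| <= eps / 8.
  rewrite normrM normfV normr_nat ler_pdivrMl //; apply: le_trans (spread_le c01) _.
  by rewrite -ler_pdivrMr ?divr_gt0.
have SE : S = \sum_(m < M) cube_sum a m + \sum_(M <= m < n.+1 | m%:R < c * n%:R) cube_sum a m.
  rewrite /S -(big_mkord (fun m => m%:R < c * n%:R) (cube_sum a)).
  rewrite (big_cat_nat _ (n := M)) //=; last by apply: leq_trans Mn _.
  congr (_ + _); rewrite big_mkord; apply: eq_bigl => m.
  by apply: lt_le_trans M_le; rewrite ltr_nat.
have tail_le : `|\sum_(M <= m < n.+1 | m%:R < c * n%:R) cube_sum a m| <= eps / 8.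
  apply: le_trans (ler_norm_sum _ _ _) _.
  apply: (@le_trans _ _ (\sum_(M <= m < n.+1) (2 * 2^-1 ^+ m))).
    rewrite big_mkcond /= big_nat_cond [X in _ <= X]big_nat_cond; apply: ler_sum => m.
    rewrite andbT => /andP[Mm _]; case: ifP => [mc|_]; last by rewrite mulr_ge0 ?exprn_ge0 ?invr_ge0.
    apply: (cube_sum_sparse a_spec n_gt0); last exact: ltW.
      exact: leq_trans J_gt0 (leq_trans JM Mm).
    by apply: le_trans hJ2 _; rewrite ler_nat (leq_trans J2_le (leq_trans JM Mm)).
  apply: le_trans (half_pow_sum _ _) _.
  rewrite exprVn ler_pdivrMr ?exprn_gt0 // mulrC -ler_pdivrMr ?divr_gt0 //.
  apply: (le_trans hJ3); rewrite -natrX ler_nat.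
  exact: leq_trans (leq_trans J3_le JM) (ltnW (ltn_expl _ (isT : (1 < 2)%N))).
have head_le : `|\sum_(m < M) cube_sum a m - \sum_(k < J) cube_sum_limit R k| <= eps / 8.
  have s_gt0 : 0 < Num.sqrt n%:R :> R by rewrite sqrtr_gt0.
  rewrite -(ler_pM2r s_gt0); apply: le_trans (hC _ _ _ a_spec n_gt0 g5) _.
  rewrite mulrC -ler_pdivrMr ?divr_gt0 //.
  have q_ge0 : 0 <= C / (eps / 8) by rewrite divr_ge0 // divr_ge0 // ltW.
  by rewrite -[X in X <= _]ger0_norm // -sqrtr_sqr ler_wsqrtr.
have series_le : `|\sum_(k < J) cube_sum_limit R k - expR (- 2^-1)| <= eps / 8.
  exact: hJ1.
rewrite SE.
move: (\sum_(m < M) _) (\sum_(M <= m < n.+1 | _) _) (\sum_(k < J) _) (n%:R^-1 * T) (expR _)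
  head_le tail_le series_le T_le => x y l w E h1 h2 h3 h4.
have -> : w + (x + y) - E = ((x - l) + (l - E)) + (y + w) by ring.
apply: le_lt_trans (ler_normD _ _) _.
have le1 := le_trans (ler_normD _ _) (lerD h1 h3); have le2 := le_trans (ler_normD _ _) (lerD h2 h4).
apply: le_lt_trans (lerD le1 le2) _.
have -> : eps / 8 + eps / 8 + (eps / 8 + eps / 8) = eps / 2 by field.
by rewrite ltr_pdivrMr // ltr_pMr // ltr1n.
Qed.

End Main.

(** The Fourier formula carries n^n and [main_term] only n^(n - 1); the surplus n is the number of
    constant tuples. *)
Lemma quotient_main_term (F : fieldType) (f n s : F) (k : nat) : f != 0 -> n != 0 -> (0 < k)%N ->
  f ^+ 3 / n ^+ k * s / (f ^+ 3 / n ^+ (k - 1)) = n^-1 * s.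
Proof.
move=> f0 n0 k_gt0; have -> : n ^+ k = n ^+ (k - 1) * n by rewrite -exprSr subn1 prednK.
have := expf_neq0 (k - 1) n0; move: (n ^+ (k - 1)) => w w0.
by field; rewrite f0 n0 w0.
Qed.

Local Close Scope ring_scope.
From Stdlib Require Import Reals.
From mathcomp Require Import Rstruct Rstruct_topology.
Theorem theorem1p2 :
  forall eps : R, (0 < eps)%R ->
  exists N : nat, forall G : finZmodType,
    (N <= #|G|)%N -> \big[GRing.add/GRing.zero]_(x : G) x = GRing.zero :> G ->
    (Rabs (INR (sum_triples G) / main_term #|G| - exp (- (1 / 2))) < eps)%R.
Proof.
move=> eps /RltP eps_gt0; have [n0 hn0] := @mean_cube_limit R eps eps_gt0.
(* At least two elements, as the encoding of characters by ['Z_n] requires. *)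
exists (maxn n0 2) => G; rewrite geq_max => /andP[n0_le n_gt1] sumG.
have [V [a [a_spec count]]] := bij_spectrum_exists R n_gt1 sumG.
apply/RltP; have := hn0 _ _ _ a_spec n0_le.
rewrite RabsE RexpE INRE count /main_term !RdivE !RpowE !INRE factE.
rewrite quotient_main_term ?pnatr_eq0 -?lt0n ?fact_gt0 ?(ltnW n_gt1) //.
by rewrite RoppE div1r.
Qed.
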